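(* Assume the eigenvalues $\lambda_1,\dots,\lambda_N$ of $R_r$ are pairwise distinct and the eigenvalues $\sigma_1,\dots,\sigma_N$ of $R_t$ are pairwise distinct, and let all parameters except $\rho$ be fixed. Define $$A(\rho)=\sum_{i=1}^N\sum_{m=1}^N\frac{\lambda_i^{-1}}{\prod_{j\ne i}(\lambda_i-\lambda_j)}\,\frac{\sigma_m^{-1}}{\prod_{n\ne m}(\sigma_m-\sigma_n)}\,\frac{1}{N!}\left[\frac{1}{(N-1)!}\Big(\frac{d_2^\tau}{\eta\theta}\Big)^N\Big(\sum_{l=1}^{N-1}\frac1l-C+\ln\frac{(1-\theta)\rho\lambda_i}{\gamma_{th}d_1^\tau}\Big)-\Big(\frac{-\sigma_m}{1-\theta}\Big)^N\right]\Big(\frac{\gamma_{th}d_1^\tau}{\rho}\Big)^N,$$ where $C$ is the Euler–Mascheroni constant. Then the outage probability $P_I(\rho)=P\{\gamma_I<\gamma_{th}\}$ satisfies $\lim_{\rho\to\infty}P_I(\rho)/A(\rho)=1$. In particular $P_I(\rho)$ decays like $\rho^{-N}\ln\rho$ (diversity order $N$).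
   Context: Fix an integer $N\ge 1$ and constants $\eta\in(0,1]$, $\theta\in(0,1)$, $d_1,d_2>0$, $\tau>0$, $\gamma_{th}>0$; $\rho>0$ is the variable. Let $R_r,R_t$ be $N\times N$ Hermitian positive definite matrices with eigenvalues $\lambda_1,\dots,\lambda_N>0$ and $\sigma_1,\dots,\sigma_N>0$ respectively. Let $h_{w1}\in\mathbb C^{N\times1}$, $h_{w2}\in\mathbb C^{1\times N}$ be independent with i.i.d. zero-mean circularly symmetric complex Gaussian entries of unit variance, $h_1=R_r^{1/2}h_{w1}$, $h_2=h_{w2}R_t^{1/2}$, and $$\gamma_I=\frac{\frac{\eta\theta(1-\theta)\rho^2}{d_1^{2\tau}d_2^\tau}\|h_2\|^2\|h_1\|^4}{\frac{\eta\theta\rho}{d_1^\tau d_2^\tau}\|h_2\|^2\|h_1\|^2+\frac{(1-\theta)\rho}{d_1^\tau}\|h_1\|^2+1}.$$ Empty products and empty sums equal $1$ and $0$ respectively. *)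

(* Defs.v *)
From HB Require Import structures.
From mathcomp Require Import all_boot all_order all_algebra.
From mathcomp Require Import all_classical all_reals all_analysis.
From mathcomp Require Import complex.
Set Implicit Arguments. Unset Strict Implicit. Unset Printing Implicit Defensive.
Import Order.TTheory GRing.Theory Num.Theory.
Import numFieldNormedType.Exports.
Local Open Scope classical_set_scope.
Local Open Scope ring_scope.

Definition harmonic {R : realType} (n : nat) : R := \sum_(1 <= l < n.+1) (l%:R)^-1.
Definition euler_mascheroni {R : realType} : R :=
  lim ((fun n : nat => harmonic n - ln (n%:R : R)) @ \oo).

Definition ctrmx {R : realType} m n (A : 'M[R[i]]_(m, n)) : 'M[R[i]]_(n, m) :=
  map_mx (@conjc R) A^T.

Definition unitary_mx {R : realType} n (U : 'M[R[i]]_n) : Prop :=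
  U *m ctrmx U = 1%:M /\ ctrmx U *m U = 1%:M.

Definition eigendecomp {R : realType} n (Rm U : 'M[R[i]]_n) (lam : 'I_n -> R) : Prop :=
  unitary_mx U /\
  Rm = U *m diag_mx (\row_k ((lam k)%:C)%C) *m ctrmx U.

Definition sqrtm_of {R : realType} n (U : 'M[R[i]]_n) (lam : 'I_n -> R) : 'M[R[i]]_n :=
  U *m diag_mx (\row_k ((Num.sqrt (lam k))%:C)%C) *m ctrmx U.

Definition sqnorm {R : realType} m n (v : 'M[R[i]]_(m, n)) : R :=
  \sum_i \sum_j (complex.Re (v i j) ^+ 2 + complex.Im (v i j) ^+ 2).

(* mutual independence of a finite family of real random variables:
   the product rule for every choice of Borel sets (taking B i = setT
   recovers the product rule for every subfamily). *)
Definition mutually_independent {R : realType} d (T : measurableType d)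
    (P : probability T R) (I : finType) (X : I -> T -> R) : Prop :=
  forall B : I -> set R, (forall i, measurable (B i)) ->
    fine (P (\bigcap_(i in [set: I]) (X i @^-1` B i))) =
    \prod_(i : I) fine (P (X i @^-1` B i)).

Definition has_normal_law {R : realType} d (T : measurableType d)
    (P : probability T R) (X : T -> R) (m s : R) : Prop :=
  forall B : set R, measurable B -> P (X @^-1` B) = normal_prob m s B.

Definition coords {R : realType} d (T : measurableType d) (N : nat)
    (re1 im1 re2 im2 : 'I_N -> T -> R) : bool * bool * 'I_N -> T -> R :=
  fun p => match p with
           | (true, true, k) => re1 k | (true, false, k) => im1 k
           | (false, true, k) => re2 k | (false, false, k) => im2 k end.

(* h_w1, h_w2 have i.i.d. zero-mean circularly-symmetric complex Gaussian
   entries of unit variance: all real and imaginary parts are independent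
   N(0, 1/2). *)
Definition iid_CSCG_pair {R : realType} d (T : measurableType d)
    (P : probability T R) (N : nat) (re1 im1 re2 im2 : 'I_N -> T -> R) : Prop :=
  (forall p, measurable_fun setT (coords re1 im1 re2 im2 p)) /\
  mutually_independent P (coords re1 im1 re2 im2) /\
  (forall p, has_normal_law P (coords re1 im1 re2 im2 p) 0 (Num.sqrt (2^-1))).

Definition cvec_of {R : realType} d (T : measurableType d) N
    (re im : 'I_N -> T -> R) (w : T) : 'cV[R[i]]_N :=
  \col_k (Complex (re k w) (im k w)).
Definition rvec_of {R : realType} d (T : measurableType d) N
    (re im : 'I_N -> T -> R) (w : T) : 'rV[R[i]]_N :=
  \row_k (Complex (re k w) (im k w)).

(* the end-to-end SNR gamma_I, as a function of ||h_1||^2, ||h_2||^2 *)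
Definition gammaI {R : realType} (eta theta d1 d2 tau rho a1 a2 : R) : R :=
  (eta * theta * (1 - theta) * rho ^+ 2 / (d1 `^ (2 * tau) * d2 `^ tau) * a2 * a1 ^+ 2) /
  (eta * theta * rho / (d1 `^ tau * d2 `^ tau) * a2 * a1
   + (1 - theta) * rho / d1 `^ tau * a1 + 1).

Definition outage {R : realType} d (T : measurableType d) (P : probability T R) N
    (Rr_half Rt_half : 'M[R[i]]_N) (re1 im1 re2 im2 : 'I_N -> T -> R)
    (eta theta d1 d2 tau gth rho : R) : R :=
  fine (P [set w | gammaI eta theta d1 d2 tau rho
                     (sqnorm (Rr_half *m cvec_of re1 im1 w))
                     (sqnorm (rvec_of re2 im2 w *m Rt_half)) < gth]).

Definition A_asym {R : realType} N (lam sig : 'I_N -> R)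
    (eta theta d1 d2 tau gth rho : R) : R :=
  \sum_(i < N) \sum_(m < N)
    ((lam i)^-1 / \prod_(j < N | j != i) (lam i - lam j)) *
    ((sig m)^-1 / \prod_(n < N | n != m) (sig m - sig n)) *
    (N`!%:R)^-1 *
    ((((N.-1)`!%:R)^-1 * (d2 `^ tau / (eta * theta)) ^+ N *
        (harmonic N.-1 - euler_mascheroni
         + ln ((1 - theta) * rho * lam i / (gth * d1 `^ tau))))
     - (- sig m / (1 - theta)) ^+ N) *
    (gth * d1 `^ tau / rho) ^+ N.

(* Main.v *)
Require Import Defs.
From HB Require Import structures.
From mathcomp Require Import all_boot all_order all_algebra.
From mathcomp Require Import all_classical all_reals all_analysis.
From mathcomp Require Import complex ring lra measurable_realfun.
Import Order.TTheory GRing.Theory Num.Theory.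
Import numFieldNormedType.Exports.
Local Open Scope classical_set_scope.
Local Open Scope ring_scope.

(** Write [X = ||h_1||^2], [Y = ||h_2||^2], [a = eta theta rho / (d_1^tau d_2^tau)] and
    [b = (1 - theta) rho / d_1^tau], so that [gamma_I = a b Y X^2 / (a Y X + b X + 1)].
    For every [E > 1] there is [S], independent of [rho], with
    [{a X Y < gth}] included in [{gamma_I < gth}], itself included in
    [{b X < S} \/ {a X Y < gth E}]; the event [{b X < S}] only contributes [O(rho^-N)].
    Everything thus reduces to the tail of [X Y] at 0.

    The Gaussian density is nearly constant near the origin, so
    [P(X < x) ~ x^N / (N! det R_r)], and similarly for [Y]. Slicing along [e^{-h(m+1)} <= X < e^{-hm}]
    makes [O(ln (1/t))] slices contribute almost equally to [P(X Y < t)], which is therefore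
    equivalent to [N t^N ln (1/t) / (N!^2 det R_r det R_t)].

    By Lagrange interpolation, [rho^N A(rho) = c ln rho + O(1)] with the matching constant [c];
    the Euler-Mascheroni constant and the other bounded terms do not affect the limit. *)

(** * Independence of the sigma-algebras generated by disjoint subfamilies *)

(** The slice width [h] is fixed before [t] tends to 0, so the tail of [X Y] is known only up to a
    factor [expR (N h)] or [expR (- N h)] on its leading term and an additive constant depending on
    [h]. This suffices because the leading term carries a logarithm: [rho] goes to infinity first,
    [h] to 0 afterwards. Relative errors near the origin are recorded as [expR (- (K * x))] rather
    than as [o(1)]. This form is explicit enough to be summed over logarithmically many slices,
    survives integration over []0, x]] with the same [K], and multiplies when one more Gaussian
    coordinate is integrated out. Independence is assumed as a product rule for the real
    coordinates, while the proof conditions on functions of many of them. It is therefore extended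
    to generated sigma-algebras, and conditioning on a group of coordinates is expressed by the
    identity map into the same sample space with a smaller sigma-algebra. *)

Section independence.
Context (R : realType) (d : measure_display) (T : measurableType d)
  (P : probability T R).

(** Both sides are finite measures in [E]: [P] restricted to [F], and [P] scaled by [P F]. They
    agree on a pi-system containing [setT], hence on the sigma-algebra it generates. *)
Lemma independent_sigma_algebra_left (G : set (set T)) (F : set T) :
  G `<=` measurable -> setI_closed G -> G setT -> measurable F ->
  (forall E, G E -> P (E `&` F) = (P E * P F)%E) ->
  forall E, <<s G >> E -> P (E `&` F) = (P E * P F)%E.
Proof.
move=> Gm GI GT mF GF E GE.
have PF : P F \is a fin_num by exact: fin_num_measure.
have PF0 : (0 <= fine (P F)) by exact: fine_ge0.
transitivity (mscale (NngNum PF0) P E); last first.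
  by rewrite /mscale/= fineK// muleC.
rewrite -[LHS]/(mrestr P mF E).
apply: (g_sigma_algebra_measure_unique G Gm (fun _ => setT)) => //.
- by rewrite bigcup_const.
- by move=> A GA /=; rewrite /mrestr/mscale/= fineK// GF// muleC.
- by move=> k; rewrite /= /mrestr setTI (le_lt_trans (probability_le1 _ _))// ltry.
Qed.

Lemma independent_sigma_algebra (G H : set (set T)) :
  G `<=` measurable -> setI_closed G -> G setT ->
  H `<=` measurable -> setI_closed H -> H setT ->
  (forall E F, G E -> H F -> P (E `&` F) = (P E * P F)%E) ->
  forall E F, <<s G >> E -> <<s H >> F -> P (E `&` F) = (P E * P F)%E.
Proof.
move=> Gm GI GT Hm HI HT GH E F GE HF.
have sGm := smallest_sub (@sigma_algebra_measurable _ T) Gm.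
rewrite setIC muleC; apply: (@independent_sigma_algebra_left H) => //.
  exact: sGm.
move=> B HB; rewrite setIC muleC; apply: (@independent_sigma_algebra_left G) => //.
  exact: Hm.
by move=> A GA; exact: GH.
Qed.

Context (I : finType) (X : I -> T -> R).
Hypothesis mX : forall i, measurable_fun setT (X i).
Hypothesis indX : mutually_independent P X.

(** Indexing [B] by the whole of [I] lets cylinders over one [J] intersect componentwise, and
    cylinders over different sets be merged into one family. *)
Definition cylinders (J : {set I}) : set (set T) :=
  [set E | exists2 B : I -> set R, (forall i, measurable (B i)) &
     E = \bigcap_(i in [set i | i \in J]) (X i @^-1` B i)].

Let mpre i (B : set R) : measurable B -> measurable (X i @^-1` B).
Proof. by move=> mB; rewrite -[X in measurable X]setTI; exact: mX. Qed.

Lemma cylinders_measurable J : cylinders J `<=` measurable.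
Proof.
by move=> _ [B mB ->]; apply: fin_bigcap_measurable => // i _; exact: mpre.
Qed.

Lemma cylinders_setI J : setI_closed (cylinders J).
Proof.
move=> _ _ [A mA ->] [B mB ->]; exists (fun i => A i `&` B i).
  by move=> i; exact: measurableI.
by rewrite -bigcapI; apply: eq_bigcapr => i _; rewrite preimage_setI.
Qed.

Lemma cylinders_setT J : cylinders J setT.
Proof.
exists (fun=> setT) => //; apply/esym; rewrite -subTset => w _ i _ //.
Qed.

Lemma cylinders_probability (J : {set I}) (B : I -> set R) : (forall i, measurable (B i)) ->
  P (\bigcap_(i in [set i | i \in J]) (X i @^-1` B i)) =
  (\prod_(i in J) fine (P (X i @^-1` B i)))%:E.
Proof.
move=> mB.
(* Padding with [setT] turns the product rule for the full family into one for [J], the extra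
   factors being 1. *)
pose D i := if i \in J then B i else setT.
have mD i : measurable (D i) by rewrite /D; case: ifP.
rewrite (_ : \bigcap_(i in _) _ = \bigcap_(i in [set: I]) (X i @^-1` D i)).
  rewrite -[LHS]fineK; last first.
    apply: fin_num_measure; apply: fin_bigcap_measurable => // i _; exact: mpre.
  rewrite indX// (bigID (fun i => i \in J))/= mulrC big1 ?mul1r; last first.
    move=> i /negbTE iJ; rewrite /D iJ preimage_setT probability_setT//.
  by congr EFin; apply: eq_bigr => i iJ; rewrite /D iJ.
apply/seteqP; split => [w /= wJ i _ /=|w /= wJ i iJ].
  by rewrite /D; case: ifPn => // iJ; exact: wJ.
by have := wJ i Logic.I; rewrite /= /D iJ.
Qed.

Lemma cylinders_independent (J K : {set I}) : (forall i, i \in J -> i \notin K) ->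
  forall E F, <<s cylinders J >> E -> <<s cylinders K >> F ->
  P (E `&` F) = (P E * P F)%E.
Proof.
move=> JK; apply: independent_sigma_algebra;
  do ?[exact: cylinders_measurable|exact: cylinders_setI|exact: cylinders_setT].
move=> _ _ [A mA ->] [B mB ->]; rewrite !cylinders_probability//.
(* By disjointness [D] agrees with [A] on [J] and with [B] on [K], so the intersection is a single
   cylinder over the union. *)
pose D i := if i \in J then A i else B i.
have mD i : measurable (D i) by rewrite /D; case: ifP.
have DJ i : i \in J -> D i = A i by rewrite /D => ->.
have DK i : i \in K -> D i = B i.
  by rewrite /D; case: ifPn => // /JK/negbTE ->.
rewrite (_ : _ `&` _ = \bigcap_(i in [set i | i \in J :|: K]) (X i @^-1` D i)).
  rewrite cylinders_probability// -EFinM; congr EFin.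
  rewrite (eq_bigl [predU J & K])/=; last first.
    by move=> i; rewrite !inE.
  rewrite bigU/=; last first.
    by apply/pred0P => i /=; case: (boolP (i \in J)) => //= /JK/negbTE.
  congr *%R; apply: eq_bigr => i iJ; first by rewrite DJ.
  by rewrite DK.
apply/seteqP; split => [w [/= wJ wK] i /=|w /= wJ].
  rewrite inE => /orP[iJ|iK]; first by rewrite DJ//; exact: wJ.
  by rewrite DK//; exact: wK.
split=> i /= iJ; have /= := wJ i; rewrite inE iJ ?orbT => /(_ isT).
  by rewrite DJ.
by rewrite DK.
Qed.

Lemma measurable_cylinders (J : {set I}) i : i \in J ->
  measurable_fun (setT : set (g_sigma_algebraType (cylinders J))) (X i).
Proof.
move=> iJ _ B mB; rewrite setTI; apply: sub_sigma_algebra.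
exists (fun j => if j == i then B else setT); first by move=> j; case: ifP.
apply/seteqP; split => [w /= wB j /= _|w /= /(_ i iJ)/=]; last by rewrite eqxx.
by case: eqP => // ->.
Qed.

End independence.

(** * Gaussian measure of a small disc *)

Section disc.
Context (R : realType).
Local Notation mu := (@lebesgue_measure R).

(* By the substitution [u = sqrt t * sin x - c]. *)
Lemma integral_half_disc (c t : R) : 0 < t ->
  (\int[mu]_(u in `[(- c - Num.sqrt t)%R, (- c + Num.sqrt t)%R])
     (Num.sqrt (t - (u + c) ^+ 2))%:E)%E = (pi * t / 2)%:E.
Proof.
move=> t0; set s := Num.sqrt t.
have s0 : 0 < s by rewrite sqrtr_gt0.
have s2 : s ^+ 2 = t by rewrite sqr_sqrtr// ltW.
pose F (x : R) : R := s * sin x - c.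
pose G (u : R) : R := Num.sqrt (t - (u + c) ^+ 2).
have pi0 := pi_gt0 R.
have Fa : F (- (pi / 2)) = - c - s by rewrite /F sinN sin_pihalf; ring.
have Fb : F (pi / 2) = - c + s by rewrite /F sin_pihalf; ring.
have dF x : is_derive x (1:R) F (s * cos x).
  rewrite /F; apply: is_derive_eq.
  by rewrite oppr0 addr0.
have F'E : derive1 F = (fun x => s * cos x).
  by apply/funext => x; rewrite derive1E (@derive_val _ _ _ _ _ _ _ (dF x)).
have cF' : continuous (fun x : R => s * cos x).
  by move=> x; apply: cvgM; [exact: cvg_cst|exact: continuous_cos].
have cF : continuous F.
  by move=> x; apply/differentiable_continuous/derivable1_diffP; case: (dF x).
have cG : continuous G.
  move=> x; apply: (cvg_comp _ (@Num.sqrt R)); last exact: sqrt_continuous.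
  apply: cvgB; first exact: cvg_cst.
  apply: (cvg_comp (fun x => x + c) (fun x => x ^+ 2)); last exact: sqr_continuous.
  by apply: cvgD; [exact: cvg_id|exact: cvg_cst].
rewrite -Fa -Fb (@integration_by_substitution_increasing _ F G); last 7 first.
- by lra.
- by move=> x y xI yI xy; rewrite /F ltrD2r ltr_pM2l// ltr_sin.
- by move=> x _; rewrite F'E.
- by rewrite F'E; apply/cvg_ex; eexists; apply: cvg_at_right_filter; exact: cF'.
- by rewrite F'E; apply/cvg_ex; eexists; apply: cvg_at_left_filter; exact: cF'.
- split => [x _||]; first by case: (dF x).
  + by apply: cvg_at_right_filter; exact: cF.
  + by apply: cvg_at_left_filter; exact: cF.
- exact: continuous_subspaceT.
pose H (x : R) : R := t / 2 * (x + sin x * cos x).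
have dH x : is_derive x (1:R) H (t * cos x ^+ 2).
  rewrite /H; apply: is_derive_eq; rewrite /GRing.scale /=.
  have := cos2Dsin2 x => E; nra.
rewrite (_ : (pi * t / 2)%:E = (H (pi/2))%:E - (H (- (pi/2)))%:E)%E; last first.
  by rewrite -EFinB /H sinN cosN cos_pihalf !mulr0; congr EFin; field.
rewrite -(@continuous_FTC2 _ (fun x => t * cos x ^+ 2) H); last 4 first.
- by lra.
- by apply: continuous_subspaceT => x; apply: cvgM; [exact: cvg_cst|apply: (cvg_comp _ (fun x => x ^+ 2)); [exact: continuous_cos|exact: sqr_continuous]].
- have cH : continuous H by move=> x; apply/differentiable_continuous/derivable1_diffP; case: (dH x).
  split => [x _||]; first by case: (dH x).
  + by apply: cvg_at_right_filter; exact: cH.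
  + by apply: cvg_at_left_filter; exact: cH.
- by move=> x _; rewrite derive1E (@derive_val _ _ _ _ _ _ _ (dH x)).
apply: eq_integral => x; rewrite inE/= in_itv/= => xI.
transitivity (G (F x) * (s * cos x))%:E; first by rewrite F'E.
congr EFin; rewrite /G /F /= subrK exprMn s2.
have -> : t - t * sin x ^+ 2 = t * cos x ^+ 2 by rewrite cos2sin2; ring.
rewrite sqrtrM ?ltW// -/s sqrtr_sqr ger0_norm; last by apply: cos_ge0_pihalf.
by rewrite mulrACA -expr2 s2 -expr2.
Qed.

Lemma integralT_half_disc (c t : R) : 0 < t ->
  (\int[mu]_u (Num.sqrt (t - (u + c) ^+ 2))%:E)%E = (pi * t / 2)%:E.
Proof.
move=> t0; rewrite -(integral_half_disc c t t0) [RHS]integral_mkcond.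
apply: eq_integral => u _; rewrite patchE; case: ifPn => //.
rewrite notin_setE/= in_itv/= => /negP uI; congr EFin; apply: ler0_sqrtr.
rewrite subr_le0 leNgt; apply: contra uI => uct.
have : `|u + c| < Num.sqrt t by rewrite -sqrtr_sqr ltr_sqrt.
by rewrite ltr_norml => /andP[? ?]; apply/andP; split; lra.
Qed.

Local Notation s12 := (Num.sqrt (2^-1 : R)).

Lemma normal_half_pdfE (x : R) :
  normal_pdf 0 s12 x = (Num.sqrt pi)^-1 * expR (- x ^+ 2).
Proof.
rewrite normal_pdfE; last by rewrite sqrtr_eq0 -ltNge.
rewrite /normal_peak /normal_fun sqr_sqrtr// subr0 -[_ *+ 2]mulr_natr.
rewrite -[X in expR (_ / X)]mulr_natr mulVf// divr1.
by congr (_ * _); congr ((Num.sqrt _)^-1); field.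
Qed.

(** The Radon-Nikodym derivative is determined only almost everywhere; it is identified with
    [normal_pdf] because both have the same integral over every measurable set. *)
Lemma integral_normal_prob (m s : R) (f : R -> \bar R) :
  measurable_fun setT f -> (forall x, 0 <= f x <= 1)%E ->
  (\int[normal_prob m s]_x f x = \int[mu]_x (f x * (normal_pdf m s x)%:E))%E.
Proof.
move=> mf f01; have dom := @normal_prob_dominates R m s.
rewrite -(Radon_Nikodym_change_of_variables dom)//=; last first.
  apply/integrableP; split => //.
  apply: (@le_lt_trans _ _ (\int[normal_prob m s]_x 1)%E).
    apply: ge0_le_integral => //=.
    - exact: measurableT_comp.
    - by move=> x _; have /andP[f0 f1] := f01 x; rewrite gee0_abs.
  by rewrite integral_cst// mul1e (le_lt_trans (probability_le1 _ _))// ltry.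
have mpdf : measurable_fun setT (fun x => (normal_pdf m s x)%:E).
  by apply/measurable_EFinP; exact: measurable_normal_pdf.
apply: ae_eq_integral => //.
- by apply: emeasurable_funM => //; apply: (measurable_int mu);
    apply: Radon_Nikodym_integrable; exact: dom.
- exact: emeasurable_funM.
- apply: ae_eqe_mul2l => /=.
  rewrite Radon_NikodymE//=; case: cid => /= h [h1 h2 h3].
  apply: integral_ae_eq => //=.
  by move=> E _ mE; rewrite -h3.
Qed.

(** The centre is [(- c1, - c2)] and [t], of any sign, stands for the squared radius. *)
Definition disc (c1 c2 t : R) : set (R * R) :=
  [set z | (z.1 + c1) ^+ 2 + (z.2 + c2) ^+ 2 < t].

(** This holds for every [u]: off the disc [Num.sqrt] returns 0 and the open interval is empty. *)
Lemma xsection_disc (c1 c2 t u : R) :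
  xsection (disc c1 c2 t) u =
  `](- c2 - Num.sqrt (t - (u + c1) ^+ 2)), (- c2 + Num.sqrt (t - (u + c1) ^+ 2))[%classic.
Proof.
apply/seteqP; split => v /=; rewrite /xsection/disc/= inE/= in_itv/=.
  move=> uvt; have : `|v + c2| < Num.sqrt (t - (u + c1) ^+ 2).
    by rewrite -sqrtr_sqr ltr_sqrt; have := sqr_ge0 (v + c2); lra.
  by rewrite ltr_norml => /andP[? ?]; apply/andP; split; lra.
move=> /andP[v1 v2].
have : `|v + c2| < Num.sqrt (t - (u + c1) ^+ 2).
  by rewrite ltr_norml; apply/andP; split; lra.
rewrite -sqrtr_sqr => h.
have t0 : 0 < t - (u + c1) ^+ 2.
  by rewrite -sqrtr_gt0 (le_lt_trans _ h).
by move: h; rewrite ltr_sqrt//; lra.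
Qed.

Lemma measurable_disc (c1 c2 t : R) : measurable (disc c1 c2 t).
Proof.
rewrite (_ : disc _ _ _ = [set: R * R] `&`
  (fun z : R * R => (z.1 + c1) ^+ 2 + (z.2 + c2) ^+ 2) @^-1` `]-oo, t[).
  apply: (_ : measurable_fun setT _) => //.
  by apply: measurable_funD; apply: measurable_funX; apply: measurable_funD.
by rewrite setTI; apply/seteqP; split => z /=; rewrite in_itv.
Qed.

Local Notation nu := (normal_prob (0 : R) s12).
Local Notation pk := ((Num.sqrt (pi : R))^-1).

Lemma integral_itv_center (k a s : R) : 0 <= s ->
  (\int[mu]_(x in `](a - s)%R, (a + s)%R[) k%:E)%E = (k * (2 * s))%:E.
Proof.
move=> s0; rewrite integral_cst//= lebesgue_measure_itv/= lte_fin.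
case: ifPn => [_|]; first by rewrite -EFinB -EFinM; congr EFin; ring.
rewrite -leNgt => as_; rewrite (_ : s = 0) ?mulr0 ?mule0//; lra.
Qed.

Lemma normal_itv_le (a s : R) : 0 <= s ->
  (nu `](a - s)%R, (a + s)%R[ <= (pk * (2 * s))%:E)%E.
Proof.
move=> s0; rewrite -(integral_itv_center _ a)//.
apply: ge0_le_integral => //=.
- by move=> x _; rewrite lee_fin normal_pdf_ge0.
- apply/measurable_EFinP; apply: measurable_funTS; exact: measurable_normal_pdf.
- move=> x _; rewrite lee_fin normal_half_pdfE ler_piMr ?invr_ge0 ?sqrtr_ge0//.
  by rewrite -expR0 ler_expR oppr_le0 sqr_ge0.
Qed.

Lemma normal_itv_ge (a s r : R) : 0 <= s ->
  (forall x, a - s < x < a + s -> x ^+ 2 <= r) ->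
  ((pk * expR (- r) * (2 * s))%:E <= nu `](a - s)%R, (a + s)%R[)%E.
Proof.
move=> s0 xr; rewrite -(integral_itv_center _ a)//.
apply: ge0_le_integral => //=.
- apply/measurable_EFinP; apply: measurable_funTS; exact: measurable_normal_pdf.
- move=> x; rewrite in_itv/= => /xr x2r.
  rewrite lee_fin normal_half_pdfE ler_wpM2l ?invr_ge0 ?sqrtr_ge0//.
  by rewrite ler_expR lerN2.
Qed.

Let sq (c t u : R) := Num.sqrt (t - (u + c) ^+ 2).

Let msq (c t : R) : measurable_fun setT (sq c t).
Proof.
apply: continuous_measurable_fun => x.
apply: (cvg_comp _ (@Num.sqrt R)); last exact: sqrt_continuous.
apply: cvgB; first exact: cvg_cst.
apply: (cvg_comp (fun x => x + c) (fun x => x ^+ 2)); last exact: sqr_continuous.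
by apply: cvgD; [exact: cvg_id|exact: cvg_cst].
Qed.

(** Since [pk ^+ 2] is [1 / pi], the area of the disc is normalised away; [k] is 1 in the upper
    bound below and [expR (- (2 * r))] in the lower one. *)
Let int_sq (k c t : R) : 0 <= k -> 0 < t ->
  (\int[mu]_u (pk ^+ 2 * k * (2 * sq c t u))%:E)%E = (k * t)%:E.
Proof.
move=> k0 t0; under eq_integral do rewrite mulrA EFinM.
have pk0 : 0 <= pk by rewrite invr_ge0 sqrtr_ge0.
rewrite ge0_integralZl//; last 3 first.
- by apply/measurable_EFinP; exact: msq.
- by move=> x _; rewrite lee_fin sqrtr_ge0.
- by rewrite lee_fin !mulr_ge0.
rewrite integralT_half_disc// -EFinM exprVn sqr_sqrtr ?ltW ?pi_gt0//.
congr EFin; have pi0 : (pi : R) != 0 by rewrite gt_eqF ?pi_gt0.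
by move: (pi : R) pi0 => p p0; field.
Qed.

Let disc_probE (c1 c2 t : R) : ((nu \x nu)%E (disc c1 c2 t) =
  \int[mu]_u (nu `](- c2 - sq c1 t u)%R, (- c2 + sq c1 t u)%R[ * (normal_pdf 0 s12 u)%:E))%E.
Proof.
rewrite -integral_normal_prob.
- by rewrite /product_measure1/=; apply: eq_integral => u _; rewrite xsection_disc.
- rewrite (_ : (fun _ => _) = nu \o xsection (disc c1 c2 t)).
    by apply: measurable_fun_xsection; exact: measurable_disc.
  by apply/funext => u /=; rewrite xsection_disc.
- by move=> u; rewrite measure_ge0 probability_le1.
Qed.

Let mfactor (c1 c2 t : R) : measurable_fun setT (fun u =>
  (nu `](- c2 - sq c1 t u)%R, (- c2 + sq c1 t u)%R[ * (normal_pdf 0 s12 u)%:E)%E).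
Proof.
apply: emeasurable_funM; last first.
  by apply/measurable_EFinP; exact: measurable_normal_pdf.
rewrite (_ : (fun _ => _) = nu \o xsection (disc c1 c2 t)).
  by apply: measurable_fun_xsection; exact: measurable_disc.
by apply/funext => u /=; rewrite xsection_disc.
Qed.

Lemma disc_eq0 (c1 c2 t : R) : t <= 0 -> disc c1 c2 t = set0.
Proof.
move=> t0; rewrite -subset0 => z /=; rewrite /disc/= => zt.
by have := sqr_ge0 (z.1 + c1); have := sqr_ge0 (z.2 + c2); lra.
Qed.

(* The half-variance normal density is [expR (- x ^+ 2) / sqrt pi], at most [1 / sqrt pi];
   the area [pi * t] of the disc cancels the two factors [1 / sqrt pi]. *)
Lemma disc_prob_le (c1 c2 t : R) : 0 < t ->
  ((nu \x nu)%E (disc c1 c2 t) <= t%:E)%E.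
Proof.
move=> t0; rewrite disc_probE.
rewrite -[X in (_ <= X%:E)%E]mul1r -(int_sq 1 c1 t ler01 t0).
apply: ge0_le_integral => //=.
- by move=> u _; rewrite mule_ge0// lee_fin normal_pdf_ge0.
- exact: mfactor.
- apply/measurable_EFinP; do 2 apply: measurable_funM => //; exact: msq.
move=> u _; rewrite (le_trans (lee_wpmul2r _ (normal_itv_le _ _ (sqrtr_ge0 _))))//.
  by rewrite lee_fin normal_pdf_ge0.
rewrite -EFinM lee_fin (_ : pk ^+ 2 * 1 * _ = pk * (2 * sq c1 t u) * pk); last by ring.
have pk0 : 0 <= pk by rewrite invr_ge0 sqrtr_ge0.
rewrite ler_wpM2l ?mulr_ge0 ?sqrtr_ge0// normal_half_pdfE ler_piMr//.
by rewrite -expR0 ler_expR oppr_le0 sqr_ge0.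
Qed.

(** On the disc each of the two density factors is at least [pk * expR (- r)], whence the exponent
    [2 * r]. *)
Lemma disc_prob_ge (c1 c2 t r : R) : 0 < t ->
  (forall z, disc c1 c2 t z -> z.1 ^+ 2 <= r /\ z.2 ^+ 2 <= r) ->
  ((expR (- (2 * r)) * t)%:E <= (nu \x nu)%E (disc c1 c2 t))%E.
Proof.
move=> t0 zr; rewrite disc_probE -(int_sq (expR (- (2 * r))) c1 t (expR_ge0 _) t0).
apply: ge0_le_integral => //=.
- by move=> u _; rewrite lee_fin !mulr_ge0 ?expR_ge0 ?sqrtr_ge0 ?exprn_ge0 ?invr_ge0 ?sqrtr_ge0.
- apply/measurable_EFinP; do 2 apply: measurable_funM => //; exact: msq.
- exact: mfactor.
move=> u _; have pk0 : 0 <= pk by rewrite invr_ge0 sqrtr_ge0.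
(* A degenerate chord makes the left side 0. A nondegenerate one puts its midpoint [(u, - c2)] in
   the disc, which is what bounds [u ^+ 2]. *)
have := sqrtr_ge0 (t - (u + c1) ^+ 2); rewrite -/(sq c1 t u) le_eqVlt => /predU1P[<-|sq0].
  by rewrite !mulr0 mule_ge0// lee_fin normal_pdf_ge0.
have ur : u ^+ 2 <= r.
  have [] // := zr (u, - c2); rewrite /disc/= addNr expr0n addr0.
  by move: sq0; rewrite /sq sqrtr_gt0 subr_gt0.
rewrite (_ : _ * _ = pk * expR (- r) * (2 * sq c1 t u) * (pk * expR (- r))); last first.
  by rewrite (_ : - (2 * r) = - r + - r) ?expRD; ring.
rewrite EFinM; apply: lee_pmul.
- rewrite lee_fin; apply: mulr_ge0; first by rewrite mulr_ge0 ?expR_ge0.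
  by rewrite mulr_ge0 ?ltW.
- by rewrite lee_fin mulr_ge0 ?expR_ge0.
- apply: normal_itv_ge; first exact: ltW.
  move=> v vI; have [] // := zr (u, v).
  have : xsection (disc c1 c2 t) u v by rewrite xsection_disc/= in_itv.
  by rewrite /xsection/= inE.
- by rewrite lee_fin normal_half_pdfE ler_wpM2l// ler_expR lerN2.
Qed.

End disc.

(** * Conditioning on all but one complex Gaussian coordinate *)

Section mfun_of.
Context (d d' : measure_display) (T : measurableType d) (U : measurableType d')
  (f : T -> U) (mf : measurable_fun setT f).
Let mf_mixin := isMeasurableFun.Build _ _ _ _ _ mf.
Definition mfun_of : {mfun T >-> U} := HB.pack f mf_mixin.
End mfun_of.

Section peel.
Context (R : realType) (d d' : measure_display) (T : measurableType d)
  (T' : measurableType d') (P : probability T R).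
Local Notation nu := (normal_prob (0 : R) (Num.sqrt 2^-1)).

(** The joint law is the product of the marginal laws because they agree on rectangles; the product
    measure is then integrated along sections and pulled back to [T]. *)
Lemma independent_joint (U : measurableType d') (d2 : measure_display)
    (V : measurableType d2) (X : T -> U) (Y : T -> V) :
  measurable_fun setT X -> measurable_fun setT Y ->
  (forall A B, measurable A -> measurable B ->
    P (X @^-1` A `&` Y @^-1` B) = (P (X @^-1` A) * P (Y @^-1` B))%E) ->
  forall E : set (U * V), measurable E ->
  P [set w | E (X w, Y w)] = (\int[P]_w P (Y @^-1` xsection E (X w)))%E.
Proof.
move=> mX mY ind E mE.
have mXY : measurable_fun setT (fun w => (X w, Y w)) by exact: measurable_fun_pair.
pose PX := distribution P (mfun_of _ _ _ _ _ mX).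
pose PY := distribution P (mfun_of _ _ _ _ _ mY).
pose PXY := distribution P (mfun_of _ _ _ _ _ mXY).
transitivity ((PX \x PY)%E E).
  by apply/esym; exact: (@product_measure_unique _ _ _ _ _ PX PY PXY ind).
rewrite /product_measure1 /PX ge0_integral_distribution//=.
exact: (@measurable_fun_xsection _ _ _ _ _ PY).
Qed.

(** For a fixed value of [S] the event says that [(u, v)] falls in a disc. The measurability
    conjunct allows the integrand to be compared with bounds afterwards. *)
Lemma peel_gaussian_pair (u v : T -> R) (S : T -> T') (c1 c2 q : T' -> R) (a x : R) :
  measurable_fun setT u -> measurable_fun setT v -> measurable_fun setT S ->
  measurable_fun setT c1 -> measurable_fun setT c2 -> measurable_fun setT q ->
  (forall A B, measurable A -> measurable B ->
    P (u @^-1` A `&` v @^-1` B) = (nu A * nu B)%E) ->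
  (forall A (B : set (R * R)), measurable A -> measurable B ->
    P (S @^-1` A `&` (fun w => (u w, v w)) @^-1` B) =
    (P (S @^-1` A) * P ((fun w => (u w, v w)) @^-1` B))%E) ->
  0 < a ->
  P [set w | a * ((u w + c1 (S w)) ^+ 2 + (v w + c2 (S w)) ^+ 2) + q (S w) < x] =
  (\int[P]_w (nu \x nu) (disc R (c1 (S w)) (c2 (S w)) ((x - q (S w)) / a)))%E /\
  measurable_fun setT
    (fun w => (nu \x nu)%E (disc R (c1 (S w)) (c2 (S w)) ((x - q (S w)) / a))).
Proof.
move=> mu_ mv mS mc1 mc2 mq induv indS a0.
have muv : measurable_fun setT (fun w => (u w, v w)) by exact: measurable_fun_pair.
pose E : set (T' * (R * R)) :=
  [set z | a * ((z.2.1 + c1 z.1) ^+ 2 + (z.2.2 + c2 z.1) ^+ 2) + q z.1 < x].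
have mE : measurable E.
  rewrite (_ : E = setT `&` (fun z : T' * (R * R) => a * ((z.2.1 + c1 z.1) ^+ 2 +
    (z.2.2 + c2 z.1) ^+ 2) + q z.1) @^-1` `]-oo, x[); last first.
    by rewrite setTI; apply/seteqP; split => z /=; rewrite in_itv.
  suff : measurable_fun setT (fun z : T' * (R * R) => a * ((z.2.1 + c1 z.1) ^+ 2 +
    (z.2.2 + c2 z.1) ^+ 2) + q z.1) by move=> h; apply: h.
  have m1 : measurable_fun setT (fun z : T' * (R * R) => z.1) by exact: measurable_fst.
  have m2 : measurable_fun setT (fun z : T' * (R * R) => z.2) by exact: measurable_snd.
  have m21 : measurable_fun setT (fun z : T' * (R * R) => z.2.1).
    exact: measurableT_comp measurable_fst m2.
  have m22 : measurable_fun setT (fun z : T' * (R * R) => z.2.2).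
    exact: measurableT_comp measurable_snd m2.
  apply: measurable_funD; last exact: measurableT_comp mq m1.
  apply: measurable_funM => //; apply: measurable_funD; apply: measurable_funX;
    apply: measurable_funD => //.
    exact: measurableT_comp mc1 m1.
  exact: measurableT_comp mc2 m1.
have PE w : P ((fun w => (u w, v w)) @^-1` xsection E (S w)) =
    (nu \x nu)%E (disc R (c1 (S w)) (c2 (S w)) ((x - q (S w)) / a)).
  have -> : xsection E (S w) = disc R (c1 (S w)) (c2 (S w)) ((x - q (S w)) / a).
    apply/seteqP; split => z; rewrite /xsection /E /disc /= inE/= ltr_pdivlMr//; lra.
  pose Puv := distribution P
    (mfun_of _ _ T (measurableTypeR R * measurableTypeR R)%type _ muv).
  apply/esym; apply: (@product_measure_unique _ _ _ _ _ nu nu Puv).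
    by move=> A B mA mB; rewrite -induv.
  exact: measurable_disc.
split.
  rewrite -[LHS]/(P [set w | E (S w, (u w, v w))]) independent_joint//.
  by apply: eq_integral => w _; rewrite PE.
under eq_fun do rewrite -PE.
pose Puv := distribution P (mfun_of _ _ _ _ _ muv).
apply: (measurableT_comp (f := Puv \o xsection E)) => //.
exact: (@measurable_fun_xsection _ _ _ _ _ Puv).
Qed.

End peel.

(** * Hermitian positive definite forms *)

Section quadratic_form.
Context (R : realType).
Local Notation C := R[i].

Definition nrm2 (z : C) : R := complex.Re z ^+ 2 + complex.Im z ^+ 2.

Lemma nrm2_ge0 (z : C) : 0 <= nrm2 z.
Proof. by rewrite addr_ge0 ?sqr_ge0. Qed.

Lemma nrm2E (z : C) : z^* * z = ((nrm2 z)%:C)%C.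
Proof.
case: z => a b; rewrite /nrm2; simpc.
by congr Complex; ring.
Qed.

Lemma ReD (x y : C) : complex.Re (x + y) = complex.Re x + complex.Re y.
Proof. by case: x y => ? ? [? ?]. Qed.

Lemma ctrmxM m n p (A : 'M[C]_(m, n)) (B : 'M[C]_(n, p)) :
  ctrmx (A *m B) = ctrmx B *m ctrmx A.
Proof. by rewrite /ctrmx trmx_mul map_mxM. Qed.

Lemma ctrmxD m n (A B : 'M[C]_(m, n)) : ctrmx (A + B) = ctrmx A + ctrmx B.
Proof. by rewrite /ctrmx raddfD map_mxD. Qed.

Lemma ctrmxK m n (A : 'M[C]_(m, n)) : ctrmx (ctrmx A) = A.
Proof. by apply/matrixP => i j; rewrite !mxE conjcK. Qed.

(** The form is real when [M] is Hermitian; taking the real part places its values in the ordered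
    field [R]. *)
Definition qf n (M : 'M[C]_n) (h : 'cV[C]_n) : R :=
  complex.Re ((ctrmx h *m M *m h) ord0 ord0).

Definition posdefmx n (M : 'M[C]_n) : Prop :=
  ctrmx M = M /\ forall h, h != 0 -> 0 < qf n M h.

Lemma qf0 n (M : 'M[C]_n) : qf n M 0 = 0.
Proof. by rewrite /qf mulmx0 mxE. Qed.

Lemma qf_ge0 n (M : 'M[C]_n) h : posdefmx n M -> 0 <= qf n M h.
Proof.
move=> [_ M0]; have [->|h0] := eqVneq h 0; first by rewrite qf0.
exact/ltW/M0.
Qed.

(* [M'] is the Schur complement of the upper left entry [a]. *)
Lemma schur_complement n (M : 'M[C]_(1 + n)) : posdefmx _ M ->
  exists a : R, exists l : 'rV[C]_n, exists M' : 'M[C]_n,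
  [/\ 0 < a, posdefmx _ M',
      forall (z : 'M[C]_1) (h : 'cV[C]_n),
        qf _ M (col_mx z h) =
          a * nrm2 (z ord0 ord0 + (l *m h) ord0 ord0) + qf _ M' h &
      \det M = (a%:C)%C * \det M'].
Proof.
move=> [MH Mp].
pose A := ulsubmx M; pose B := ursubmx M; pose D := drsubmx M.
have ctrb : M = block_mx A B (ctrmx B) D.
  rewrite -[LHS]submxK /A /B /D; congr block_mx.
  by rewrite -{1}MH /ctrmx; apply/matrixP => i j; rewrite !mxE.
have AH : ctrmx A = A.
  by rewrite -{2}[A]/(ulsubmx M) -MH; apply/matrixP => i j; rewrite !mxE.
have DH : ctrmx D = D.
  by rewrite -{2}[D]/(drsubmx M) -MH; apply/matrixP => i j; rewrite !mxE.
pose a := complex.Re (A ord0 ord0).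
have Aa : A = ((a%:C)%C)%:M.
  rewrite [LHS]mx11_scalar; congr (_%:M).
  have /matrixP/(_ ord0 ord0) := AH; rewrite !mxE /a /A.
  rewrite !mxE; case: (M _ _) => x y /= [] yy; congr Complex; lra.
have qfE (z : 'M[C]_1) (h : 'cV[C]_n) : ctrmx (col_mx z h) *m M *m col_mx z h =
  ctrmx z *m A *m z + ctrmx h *m ctrmx B *m z + (ctrmx z *m B *m h + ctrmx h *m D *m h).
  rewrite ctrb /ctrmx tr_col_mx map_row_mx mul_row_block mul_row_col.
  by rewrite !mulmxDl.
have a0 : 0 < a.
  have : 0 < qf _ M (col_mx 1%:M 0).
    apply: Mp; apply/negP => /eqP/matrixP/(_ (lshift n ord0) ord0).
    by rewrite col_mxEu !mxE/= => /eqP; rewrite oner_eq0.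
  rewrite /qf qfE !mulmx0 !addr0 /ctrmx trmx1 map_mx1 mul1mx mulmx1.
  by rewrite trmx0 map_mx0 !mul0mx addr0.
pose l := ((a^-1)%:C)%C *: B.
pose M' := D - ctrmx B *m l.
have aC0 : (a%:C)%C * ((a^-1)%:C)%C = 1 :> C by rewrite -rmorphM mulfV ?gt_eqF.
have ctrl : ctrmx l = ((a^-1)%:C)%C *: ctrmx B.
  by apply/matrixP => i j; rewrite !mxE rmorphM/= oppr0.
have Al : A *m l = B by rewrite Aa mul_scalar_mx scalerA aC0 scale1r.
have lA : ctrmx l *m A = ctrmx B by rewrite Aa mul_mx_scalar ctrl scalerA aC0 scale1r.
have key (z : 'M[C]_1) (h : 'cV[C]_n) : ctrmx (col_mx z h) *m M *m col_mx z h =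
  ctrmx (z + l *m h) *m A *m (z + l *m h) + ctrmx h *m M' *m h.
  rewrite qfE ctrmxD ctrmxM !mulmxDl -(mulmxA (ctrmx h) (ctrmx l) A) lA !mulmxDr.
  have -> : ctrmx z *m A *m (l *m h) = ctrmx z *m B *m h.
    by rewrite -mulmxA (mulmxA A) Al mulmxA.
  rewrite mulmxN mulmxDl mulNmx !mulmxA.
  move: (ctrmx z *m A *m z) (ctrmx h *m ctrmx B *m z) (ctrmx z *m B *m h)
    (ctrmx h *m D *m h) (ctrmx h *m ctrmx B *m l *m h) => x1 x2 x3 x4 x5.
  by rewrite [x4 - x5]addrC addrACA -[RHS]addrA [x2 + x5 + _]addrA addrK -!addrA [x3 + (x2 + _)]addrCA.
have qfkey (z : 'M[C]_1) (h : 'cV[C]_n) : qf _ M (col_mx z h) =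
    a * nrm2 (z ord0 ord0 + (l *m h) ord0 ord0) + qf _ M' h.
  rewrite /qf key mxE ReD; congr (_ + _).
  rewrite Aa mul_mx_scalar -scalemxAl mxE mxE big_ord1 !mxE nrm2E.
  by rewrite -rmorphM.
exists a, l, M'; split => //.
- split=> [|h h0].
    by rewrite /M' /ctrmx raddfB map_mxB -!/(ctrmx _) DH ctrmxM ctrmxK ctrl -scalemxAl -scalemxAr.
  (* This choice of first coordinate annihilates the completed square and leaves the form of [M']
     alone. *)
  have := Mp (col_mx (- (l *m h)) h).
  rewrite qfkey mxE addNr /nrm2 /= expr0n addr0 mulr0 add0r; apply.
  apply: contra h0 => /eqP; rewrite -col_mx0 => /eq_col_mx[_ ->]; exact: eqxx.
- rewrite ctrb.
  (* Block elimination: the left factor is unipotent, so the determinant is that of the block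
     triangular right factor. *)
  have -> : block_mx A B (ctrmx B) D =
      block_mx (1%:M : 'M[C]_1) 0 (ctrmx l) 1%:M *m block_mx A B 0 M'.
    rewrite mulmx_block !mul1mx !mul0mx !addr0 lA; congr block_mx.
    by rewrite /M' ctrl -scalemxAl /l -scalemxAr addrC subrK.
  by rewrite det_mulmx det_lblock det_ublock !det1 !mul1r Aa det_scalar1.
Qed.

Lemma nrm2D (x y : C) : nrm2 (x + y) <= 2 * (nrm2 x + nrm2 y).
Proof.
case: x y => a b [a' b']; rewrite /nrm2 /=.
by have := sqr_ge0 (a - a'); have := sqr_ge0 (b - b'); lra.
Qed.

Lemma nrm2M (x y : C) : nrm2 (x * y) = nrm2 x * nrm2 y.
Proof. by case: x y => a b [a' b']; rewrite /nrm2 /=; ring. Qed.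

(** The inequality [|x + y|^2 <= 2 (|x|^2 + |y|^2)] is iterated; the factor is crude, but only the
    existence of a constant is needed. *)
Lemma nrm2_sum (I : Type) (s : seq I) (f : I -> C) :
  nrm2 (\sum_(i <- s) f i) <= 2 ^+ size s * \sum_(i <- s) nrm2 (f i).
Proof.
elim: s => [|i s IH]; first by rewrite !big_nil /nrm2 /= expr0n addr0 mulr0.
rewrite !big_cons /= exprS -mulrA; apply: le_trans (nrm2D _ _) _.
rewrite ler_wpM2l// mulrDr lerD// ler_peMl ?nrm2_ge0//.
by rewrite exprn_ege1// ler1n.
Qed.

Lemma linear_form_bound n (l : 'rV[C]_n) : exists2 K : R, 0 <= K &
  forall h : 'cV[C]_n, nrm2 ((l *m h) ord0 ord0) <= K * \sum_i nrm2 (h i ord0).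
Proof.
exists (2 ^+ size (index_enum 'I_n) * \sum_i nrm2 (l ord0 i)).
  by rewrite mulr_ge0 ?exprn_ge0// sumr_ge0// => i _; exact: nrm2_ge0.
move=> h; rewrite mxE; apply: le_trans (nrm2_sum _ _ _) _.
rewrite -mulrA ler_wpM2l ?exprn_ge0// mulr_suml; apply: ler_sum => i _.
rewrite nrm2M ler_wpM2l ?nrm2_ge0//.
by rewrite (bigD1 i)//= lerDl sumr_ge0// => j _; exact: nrm2_ge0.
Qed.

(** Definiteness is made quantitative through the Schur recursion. The bound confines every
    coordinate on the event [qf M h < x] to size [O(sqrt x)], where the Gaussian density is nearly
    constant. *)
Lemma posdefmx_coercive n (M : 'M[C]_n) : posdefmx _ M -> exists2 K : R, 0 <= K &
  forall h : 'cV[C]_n, \sum_i nrm2 (h i ord0) <= K * qf _ M h.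
Proof.
elim: n M => [|n IH] M Mp.
  by exists 0 => // h; rewrite big_ord0 mul0r.
have [a [l [M' [a0 M'p qfE _]]]] := @schur_complement n M Mp.
have [K K0 hK] := IH M' M'p.
have [L L0 hL] := linear_form_bound _ l.
(* With [w] the completed-square coordinate and [s] the squared norm of the others,
   [|z|^2 + s <= 2 |w|^2 + (2 L + 1) s]. The first term is at most [2 / a] times the form, the
   second at most [(2 L + 1) K] times. *)
exists (2 * a^-1 + (2 * L + 1) * K).
  by rewrite addr_ge0 ?mulr_ge0 ?addr_ge0 ?invr_ge0 ?mulr_ge0// ltW.
move=> h; pose z := @usubmx _ 1 n 1 h; pose h' := @dsubmx _ 1 n 1 h.
have -> : \sum_i nrm2 (h i ord0) = nrm2 (z ord0 ord0) + \sum_i nrm2 (h' i ord0).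
  rewrite (@big_split_ord _ _ _ 1 n) big_ord1 /=; congr (nrm2 _ + _).
    by rewrite mxE.
  by apply: eq_bigr => i _; rewrite mxE.
have -> : h = col_mx z h' by rewrite vsubmxK.
rewrite qfE.
set w := z ord0 ord0 + _; set s := \sum_i _.
have s0 : 0 <= s by apply: sumr_ge0 => i _; exact: nrm2_ge0.
have zw : nrm2 (z ord0 ord0) <= 2 * (nrm2 w + L * s).
  have -> : z ord0 ord0 = w + - ((l *m h') ord0 ord0) by rewrite addrK.
  apply: le_trans (nrm2D _ _) _; rewrite ler_wpM2l// lerD2l.
  apply: le_trans (hL h'); rewrite /nrm2; case: ((l *m h') _ _) => x y /=.
  by rewrite !sqrrN.
have w0 := nrm2_ge0 w.
have q0 := qf_ge0 _ _ h' M'p.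
have sK : s <= K * qf _ M' h' by exact: hK.
have -> : (2 * a^-1 + (2 * L + 1) * K) * (a * nrm2 w + qf _ M' h') =
  2 * nrm2 w + 2 * a^-1 * qf _ M' h' + (2 * L + 1) * K * a * nrm2 w + 
    (2 * L + 1) * (K * qf _ M' h').
  by field; rewrite gt_eqF.
have h1 : 0 <= 2 * a^-1 * qf _ M' h' by rewrite !mulr_ge0 ?invr_ge0// ltW.
have h2 : 0 <= (2 * L + 1) * K * a * nrm2 w.
  apply: mulr_ge0 => //; apply: mulr_ge0; last exact: ltW.
  by apply: mulr_ge0 => //; lra.
have h3 : (2 * L + 1) * s <= (2 * L + 1) * (K * qf _ M' h').
  by rewrite ler_wpM2l ?addr_ge0 ?mulr_ge0.
lra.
Qed.

Section measurability.
Context (d : measure_display) (T : measurableType d).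

Definition cmeasurable (f : T -> C) :=
  measurable_fun setT (fun w => complex.Re (f w)) /\
  measurable_fun setT (fun w => complex.Im (f w)).

Lemma cmeasurable_cst c : cmeasurable (fun=> c).
Proof. by split. Qed.

Lemma cmeasurableD f g : cmeasurable f -> cmeasurable g ->
  cmeasurable (fun w => f w + g w).
Proof.
move=> [fr fi] [gr gi]; split.
  rewrite (_ : (fun _ => _) = (fun w => complex.Re (f w) + complex.Re (g w))).
    exact: measurable_funD.
  by apply/funext => w; case: (f w) (g w) => ? ? [].
rewrite (_ : (fun _ => _) = (fun w => complex.Im (f w) + complex.Im (g w))).
  exact: measurable_funD.
by apply/funext => w; case: (f w) (g w) => ? ? [].
Qed.

Lemma cmeasurableM f g : cmeasurable f -> cmeasurable g ->
  cmeasurable (fun w => f w * g w).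
Proof.
move=> [fr fi] [gr gi]; split.
  rewrite (_ : (fun _ => _) = (fun w => complex.Re (f w) * complex.Re (g w)
      - complex.Im (f w) * complex.Im (g w))).
    by apply: measurable_funB; exact: measurable_funM.
  by apply/funext => w; case: (f w) (g w) => ? ? [].
rewrite (_ : (fun _ => _) = (fun w => complex.Re (f w) * complex.Im (g w)
    + complex.Im (f w) * complex.Re (g w))).
  by apply: measurable_funD; exact: measurable_funM.
by apply/funext => w; case: (f w) (g w) => ? ? [].
Qed.

Lemma cmeasurable_conj f : cmeasurable f -> cmeasurable (fun w => conjc (f w)).
Proof.
move=> [fr fi]; split.
  by rewrite (_ : (fun _ => _) = (fun w => complex.Re (f w)))//;
    apply/funext => w; case: (f w).
rewrite (_ : (fun _ => _) = (fun w => - complex.Im (f w))).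
  exact: measurableT_comp.
by apply/funext => w; case: (f w).
Qed.

Lemma cmeasurable_sum (I : Type) (s : seq I) (f : I -> T -> C) :
  (forall i, cmeasurable (f i)) -> cmeasurable (fun w => \sum_(i <- s) f i w).
Proof.
move=> mf; elim: s => [|i s IH].
  by under eq_fun do rewrite big_nil; exact: cmeasurable_cst.
by under eq_fun do rewrite big_cons; exact: cmeasurableD.
Qed.

Lemma cmeasurable_linear_form n (l : 'rV[C]_n) (h : T -> 'cV[C]_n) :
  (forall k, cmeasurable (fun w => h w k ord0)) ->
  cmeasurable (fun w => (l *m h w) ord0 ord0).
Proof.
move=> mh; under eq_fun do rewrite mxE.
by apply: cmeasurable_sum => i; apply: cmeasurableM => //; exact: cmeasurable_cst.
Qed.

Lemma measurable_qf n (M : 'M[C]_n) (h : T -> 'cV[C]_n) :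
  (forall k, cmeasurable (fun w => h w k ord0)) ->
  measurable_fun setT (fun w => qf n M (h w)).
Proof.
move=> mh; suff [] : cmeasurable (fun w => (ctrmx (h w) *m M *m h w) ord0 ord0) by [].
under eq_fun do rewrite mxE.
apply: cmeasurable_sum => i; apply: cmeasurableM => //.
under eq_fun do rewrite mxE.
apply: cmeasurable_sum => j; apply: cmeasurableM; last exact: cmeasurable_cst.
by under eq_fun do rewrite !mxE; exact: cmeasurable_conj.
Qed.

End measurability.

Lemma sqnorm_col n (v : 'cV[C]_n) :
  sqnorm v = complex.Re ((ctrmx v *m v) ord0 ord0).
Proof.
rewrite /sqnorm mxE; under eq_bigr do rewrite big_ord1.
elim/big_ind2: _ => // [x x' y y' -> ->|i _]; first by rewrite ReD.
by rewrite !mxE nrm2E.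
Qed.

Lemma sqnorm_tr m n (v : 'M[C]_(m, n)) : sqnorm v = sqnorm v^T.
Proof.
rewrite /sqnorm exchange_big; apply: eq_bigr => i _.
by apply: eq_bigr => j _; rewrite mxE.
Qed.

Lemma sqnorm_eq0 n (v : 'cV[C]_n) : sqnorm v = 0 -> v = 0.
Proof.
move=> /eqP; rewrite /sqnorm psumr_eq0; last first.
  by move=> i _; apply: sumr_ge0 => j _; exact: nrm2_ge0.
move=> /allP v0; apply/matrixP => i j; rewrite ord1 mxE.
have := v0 i; rewrite mem_index_enum => /(_ isT); rewrite big_ord1 /=.
rewrite paddr_eq0 ?sqr_ge0// !sqrf_eq0 => /andP[/eqP + /eqP].
by case: (v i ord0) => x y /= -> ->.
Qed.

(** * Norms of correlated vectors as positive definite forms *)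

Section eigendecomposition.
Context (n : nat) (Rm U : 'M[C]_n) (lam : 'I_n -> R).
Hypothesis lam0 : forall k, 0 < lam k.
Hypothesis RmE : eigendecomp Rm U lam.

Let Rm_def : Rm = U *m diag_mx (\row_k ((lam k)%:C)%C) *m ctrmx U.
Proof. by case: RmE. Qed.

Let UU : U *m ctrmx U = 1%:M. Proof. by case: RmE => -[]. Qed.
Let UcU : ctrmx U *m U = 1%:M. Proof. by case: RmE => -[]. Qed.

Lemma ctrmx_diag (f : 'I_n -> R) :
  ctrmx (diag_mx (\row_k ((f k)%:C)%C)) = diag_mx (\row_k ((f k)%:C)%C).
Proof.
apply/matrixP => i j; rewrite !mxE eq_sym; case: eqP => [->|_].
  by rewrite !mulr1n /= oppr0.
by rewrite !mulr0n rmorph0.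
Qed.

Lemma sqrtm_of_hermitian : ctrmx (sqrtm_of U lam) = sqrtm_of U lam.
Proof. by rewrite /sqrtm_of !ctrmxM ctrmxK ctrmx_diag mulmxA. Qed.

Lemma conj_diagM (f g : 'I_n -> R) :
  (U *m diag_mx (\row_k ((f k)%:C)%C) *m ctrmx U) *m
  (U *m diag_mx (\row_k ((g k)%:C)%C) *m ctrmx U) =
  U *m diag_mx (\row_k ((f k * g k)%:C)%C) *m ctrmx U.
Proof.
rewrite -!mulmxA (mulmxA (ctrmx U)) UcU mul1mx; congr (_ *m _).
rewrite !mulmxA mulmx_diag; congr (diag_mx _ *m _).
by apply/rowP => k; rewrite !mxE rmorphM.
Qed.

Lemma sqrtm_of_sqr : sqrtm_of U lam *m sqrtm_of U lam = Rm.
Proof.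
rewrite /sqrtm_of conj_diagM Rm_def; congr (_ *m diag_mx _ *m _).
by apply/rowP => k; rewrite !mxE -expr2 sqr_sqrtr// ltW.
Qed.

Lemma sqnorm_sqrtm_col (h : 'cV[C]_n) : sqnorm (sqrtm_of U lam *m h) = qf n Rm h.
Proof.
rewrite sqnorm_col /qf -sqrtm_of_sqr ctrmxM sqrtm_of_hermitian.
by rewrite !mulmxA.
Qed.

Lemma qf_tr (M : 'M[C]_n) (h : 'cV[C]_n) : qf n M^T h = qf n M (map_mx (@conjc R) h).
Proof.
rewrite /qf.
have -> : ctrmx h *m M^T *m h = (h^T *m M *m map_mx (@conjc R) h)^T.
  by rewrite !trmx_mul trmxK mulmxA map_trmx.
rewrite mxE; congr (complex.Re ((_ *m _ *m _) _ _)).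
by apply/matrixP => i j; rewrite !mxE conjcK.
Qed.

(** Transposition turns the row into a column hit by the transposed root, which is why [Rm^T]
    appears; its determinant is that of [Rm]. *)
Lemma sqnorm_sqrtm_row (v : 'rV[C]_n) : sqnorm (v *m sqrtm_of U lam) = qf n Rm^T v^T.
Proof.
have E : ctrmx (sqrtm_of U lam)^T *m (sqrtm_of U lam)^T = Rm^T.
  rewrite -sqrtm_of_sqr [RHS]trmx_mul; congr (_ *m _).
  rewrite -[in RHS]sqrtm_of_hermitian /ctrmx trmxK.
  by apply/matrixP => i j; rewrite !mxE.
by rewrite sqnorm_tr sqnorm_col /qf trmx_mul ctrmxM -E !mulmxA.
Qed.

Lemma eigendecomp_posdefmx : posdefmx n Rm.
Proof.
split; first by rewrite -sqrtm_of_sqr ctrmxM sqrtm_of_hermitian.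
move=> h h0; rewrite -sqnorm_sqrtm_col lt_def; apply/andP; split; last first.
  by apply: sumr_ge0 => i _; apply: sumr_ge0 => j _; exact: nrm2_ge0.
apply: contra h0 => /eqP/sqnorm_eq0 Sh0; apply/eqP.
(* [S'] is the inverse of the square root, so the root has trivial kernel. *)
pose S' := U *m diag_mx (\row_k (((Num.sqrt (lam k))^-1)%:C)%C) *m ctrmx U.
have S'S : S' *m sqrtm_of U lam = 1%:M.
  rewrite /S' /sqrtm_of conj_diagM -[RHS]UU; congr (_ *m _).
  rewrite -[RHS]mulmx1; congr (_ *m _); apply/matrixP => i j; rewrite !mxE.
  by rewrite mulVf// gt_eqF// sqrtr_gt0.
by rewrite -[h]mul1mx -S'S -mulmxA Sh0 mulmx0.
Qed.

Lemma eigendecomp_tr_posdefmx : posdefmx n Rm^T.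
Proof.
have [RH Rp] := eigendecomp_posdefmx; split.
  by rewrite -[in RHS]RH /ctrmx trmxK; apply/matrixP => i j; rewrite !mxE.
move=> h h0; rewrite qf_tr; apply: Rp.
apply: contra h0 => /eqP/matrixP hc; apply/eqP/matrixP => i j.
by have := hc i j; rewrite !mxE => /eqP; rewrite conjc_eq0 => /eqP.
Qed.

Lemma det_eigendecomp : \det Rm = ((\prod_k lam k)%:C)%C.
Proof.
rewrite Rm_def det_mulmx mulrC det_mulmx mulrA -det_mulmx UcU det1 mul1r det_diag.
by rewrite rmorph_prod; apply: eq_bigr => k _; rewrite mxE.
Qed.

End eigendecomposition.

End quadratic_form.

(** * Integral of a positive part *)

Section positive_part.
Context (R : realType) (d : measure_display) (T : measurableType d)
  (P : probability T R).
Local Notation mu := (@lebesgue_measure R).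

(** Layer-cake formula: the positive part of [x - q w] is the length of []q w, x]], and Tonelli
    exchanges the integrals. Since [q] is nonnegative, restricting to [0 < s] loses nothing. *)
Lemma integral_positive_part (q : T -> R) (x : R) :
  measurable_fun setT q -> (forall w, 0 <= q w) ->
  (\int[P]_w (Num.max (x - q w) 0)%R%:E =
   \int[mu]_(s in `]0%R, x]) P [set w | (q w < s)%R])%E.
Proof.
move=> mq q0.
pose A : set (T * measurableTypeR R) := [set z | q z.1 < z.2 /\ (0 < z.2 <= x)].
have m1 : measurable_fun setT (fun z : T * measurableTypeR R => q z.1).
  exact: (measurableT_comp mq (@measurable_fst _ _ T (measurableTypeR R))).
have m2 : measurable_fun setT (fun z : T * measurableTypeR R => z.2 : R).
  exact: (@measurable_snd _ _ T (measurableTypeR R)).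
have mA : measurable A.
  rewrite (_ : A = (setT `&` (fun z : T * measurableTypeR R => z.2 - q z.1) @^-1` `]0, +oo[)
    `&` (setT `&` (fun z : T * measurableTypeR R => z.2 : R) @^-1` `]0, x])); last first.
    apply/seteqP; split => z /=; rewrite !in_itv/= andbT subr_gt0; first by case.
    by case=> -[_ ?] [_ ?].
  by apply: measurableI; [have := measurable_funB m2 m1|have := m2]; apply.
have := @indic_fubini_tonelli _ _ _ _ _ P mu A mA.
rewrite indic_fubini_tonelli_FE// indic_fubini_tonelli_GE// => E.
transitivity (\int[P]_w (mu \o xsection A) w)%E.
  apply: eq_integral => w _ /=.
  rewrite (_ : xsection A w = `]q w, x]%classic); last first.
    apply/seteqP; split => s; rewrite /xsection/= inE/= in_itv/=.
      by case=> ? /andP[_ ?]; apply/andP.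
    move=> /andP[qs sx]; split => //; apply/andP; split => //.
    exact: le_lt_trans (q0 w) qs.
  rewrite lebesgue_measure_itv/= lte_fin; case: ltP => qx.
    by rewrite -EFinB; congr EFin; apply/max_idPl; rewrite subr_ge0 ltW.
  by congr EFin; apply/max_idPr; rewrite subr_le0.
rewrite E [RHS]integral_mkcond; apply: eq_integral => s _ /=.
rewrite patchE; case: ifPn; rewrite ?inE ?notin_setE/= in_itv/= => sx.
  congr (P _); apply/seteqP; split => w; rewrite /ysection/= inE/=; first by case.
  by move=> qs; split.
rewrite (_ : ysection A s = set0) ?measure0//.
by rewrite -subset0 => w; rewrite /ysection/= inE => -[_ /sx].
Qed.

Lemma integral_power (al x : R) (n : nat) : 0 < x ->
  (\int[mu]_(s in `]0%R, x]) (al * s ^+ n)%:E)%E = (al / n.+1%:R * x ^+ n.+1)%:E.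
Proof.
move=> x0; rewrite integral_itv_obnd_cbnd; last first.
  apply/measurable_EFinP; apply: measurable_funM => //.
pose F (s : R) : R := al / n.+1%:R * s ^+ n.+1.
have dF s : is_derive s (1 : R) F (al * s ^+ n).
  have dX : is_derive s (1 : R) (@GRing.exp R ^~ n.+1) (n.+1%:R * s ^+ n).
    by split; [exact: exprn_derivable|rewrite exp_derive /GRing.scale/= mulr1].
  rewrite /F; apply: is_derive_eq; rewrite /GRing.scale /=.
  by field; rewrite addrC natr1 pnatr_eq0.
rewrite (@continuous_FTC2 _ _ F)//.
- by rewrite /F expr0n/= mulr0 sube0.
- apply: continuous_subspaceT => s; apply: cvgM; first exact: cvg_cst.
  exact: exprn_continuous.
- have cF : continuous F by move=> s; apply/differentiable_continuous/derivable1_diffP; case: (dF s).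
  split => [s _||]; first by case: (dF s).
  + by apply: cvg_at_right_filter; exact: cF.
  + by apply: cvg_at_left_filter; exact: cF.
- by move=> s _; rewrite derive1E (@derive_val _ _ _ _ _ _ _ (dF s)).
Qed.

Lemma measurable_lt_level (q : T -> R) (s : R) : measurable_fun setT q ->
  measurable [set w | q w < s].
Proof.
move=> mq; rewrite (_ : [set w | _] = setT `&` q @^-1` `]-oo, s[); first exact: mq.
by rewrite setTI; apply/seteqP; split => w /=; rewrite in_itv.
Qed.

Lemma measurable_cdf_lt (q : T -> R) : measurable_fun setT q ->
  measurable_fun setT (fun s : R => P [set w | (q w < s)%R]).
Proof.
move=> mq.
have mqs s := measurable_lt_level q s mq.
rewrite (_ : (fun _ => _) = (fun s => (fine (P [set w | (q w < s)%R]))%:E)).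
  apply/measurable_EFinP; apply: nondecreasing_measurable => // s t st.
  rewrite fine_le ?fin_num_measure//; apply: le_measure; rewrite ?inE//.
  by move=> w /= /lt_le_trans; apply.
by apply/funext => s; rewrite fineK// fin_num_measure.
Qed.

(** Freezing the exponential at its least value on []0, x]], attained at [s = x], keeps the same
    [K]; integrating the power produces [1 / (n + 1)]. *)
Lemma positive_part_bounds (q : T -> R) (n : nat) (al K : R) :
  measurable_fun setT q -> (forall w, 0 <= q w) -> 0 <= al -> 0 <= K ->
  (forall s, 0 < s -> ((al * expR (- (K * s)) * s ^+ n)%:E <= P [set w | (q w < s)%R]
     <= (al * s ^+ n)%:E)%E) ->
  forall x, 0 < x ->
  ((al / n.+1%:R * expR (- (K * x)) * x ^+ n.+1)%:E <=
     \int[P]_w (Num.max (x - q w) 0)%R%:E <= (al / n.+1%:R * x ^+ n.+1)%:E)%E.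
Proof.
move=> mq q0 al0 K0 H x x0; rewrite integral_positive_part//.
apply/andP; split.
  rewrite [X in X%:E](_ : _ = (al * expR (- (K * x))) / n.+1%:R * x ^+ n.+1).
    rewrite -integral_power//; apply: ge0_le_integral => //=.
    - move=> s; rewrite in_itv/= => /andP[s0 _]; rewrite lee_fin mulr_ge0 ?exprn_ge0 ?(ltW s0)//.
      by rewrite mulr_ge0 ?expR_ge0.
    - apply/measurable_EFinP; apply: measurable_funM => //.
    - apply: measurable_funTS; exact: measurable_cdf_lt.
    - move=> s; rewrite in_itv/= => /andP[s0 sx]; have /andP[+ _] := H s s0.
      apply: le_trans; rewrite lee_fin; apply: ler_wpM2r; first by rewrite exprn_ge0 ?ltW.
      apply: ler_wpM2l => //.
      by rewrite ler_expR lerN2 ler_wpM2l.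
  ring.
rewrite -integral_power//; apply: ge0_le_integral => //=.
- apply: measurable_funTS; exact: measurable_cdf_lt.
- apply/measurable_EFinP; apply: measurable_funM => //.
- by move=> s; rewrite in_itv/= => /andP[s0 sx]; have /andP[] := H s s0.
Qed.
End positive_part.

(** * Small ball probabilities of Gaussian quadratic forms *)

Section small_ball.
Context (R : realType) (d : measure_display) (T : measurableType d)
  (P : probability T R) (I : finType) (X : I -> T -> R).
Hypothesis mX : forall i, measurable_fun setT (X i).
Hypothesis indX : mutually_independent P X.
Hypothesis lawX : forall i, has_normal_law P (X i) 0 (Num.sqrt 2^-1).
Local Notation nu := (normal_prob (0 : R) (Num.sqrt 2^-1)).
Local Notation C := R[i].

(* [iota true] and [iota false] index the real and the imaginary parts. *)
Definition gvec n (iota : bool -> 'I_n -> I) (w : T) : 'cV[C]_n :=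
  cvec_of (fun k => X (iota true k)) (fun k => X (iota false k)) w.

Lemma measurable_id_cylinders J :
  measurable_fun setT (id : T -> g_sigma_algebraType (cylinders _ _ _ _ X J)).
Proof.
move=> _ A mA; rewrite setTI.
apply: (smallest_sub (@sigma_algebra_measurable _ T)
  (cylinders_measurable _ _ _ _ _ mX J)); exact: mA.
Qed.

Lemma cmeasurable_gvec n (iota : bool -> 'I_n -> I) (J : {set I}) k :
  (forall b j, iota b j \in J) ->
  cmeasurable R _ (g_sigma_algebraType (cylinders _ _ _ _ X J))
    (fun w => gvec n iota w k ord0).
Proof.
move=> iJ; split; under eq_fun do rewrite mxE /=; exact: measurable_cylinders.
Qed.

(* Induction on [n]: completing the square isolates the first coordinate [z] as
   [a * |z + c|^2 + q] with [c], [q] depending on the others only; integrating [z] out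
   turns the event into [(x - q)^+ / a] up to the density factor. *)
Lemma small_ball n (M : 'M[C]_n) (iota : bool -> 'I_n -> I) :
  posdefmx _ _ M -> (forall b k b' k', iota b k = iota b' k' -> b = b' /\ k = k') ->
  exists2 K : R, 0 <= K & forall x, 0 < x ->
   (((n`!%:R * complex.Re (\det M))^-1 * expR (- (K * x)) * x ^+ n)%:E <=
     P [set w | (qf _ _ M (gvec n iota w) < x)%R] <=
    ((n`!%:R * complex.Re (\det M))^-1 * x ^+ n)%:E)%E.
Proof.
elim: n M iota => [|n IH] M iota Mp inj.
  exists 0 => // x x0; rewrite det_mx00 fact0 !expr0 /= mul0r oppr0 expR0 !mulr1 invr1.
  rewrite (_ : [set w | _] = setT) ?probability_setT ?lexx//.
  rewrite -subTset => w _ /=.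
  by rewrite (_ : gvec 0 iota w = 0) ?qf0//; apply/matrixP => -[].
have [a [l [M' [a0 M'p qfE detE]]]] := @schur_complement _ n M Mp.
have [Kc Kc0 hKc] := posdefmx_coercive _ _ _ Mp.
pose iota' b k := iota b (@rshift 1 n k).
have inj' b k b' k' : iota' b k = iota' b' k' -> b = b' /\ k = k'.
  by move=> /inj[-> /(@rshift_inj 1 n) ->].
have [K K0 hK] := IH M' iota' M'p inj'.
pose D' : R := (n`!%:R * complex.Re (\det M'))^-1.
pose D : R := (n.+1`!%:R * complex.Re (\det M))^-1.
(* The induction gains [a] from the determinant and [n + 1] from integrating the power. *)
have DE : D = a^-1 * (D' / n.+1%:R).
  rewrite /D /D' detE factS natrM.
  have -> : complex.Re ((a%:C)%C * \det M') = a * complex.Re (\det M').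
    by case: (\det M') => ? ? /=; rewrite mul0r subr0.
  by rewrite !invfM; ring.
pose iu := iota true (@lshift 1 n ord0); pose iv := iota false (@lshift 1 n ord0).
pose J1 : {set I} := [set i | [exists b, exists k, i == iota' b k]]%SET.
pose J0 : {set I} := [set i | (i == iu) || (i == iv)]%SET.
have J01 i : i \in J0 -> i \notin J1.
  rewrite !inE => iuv; apply/existsP => -[b /existsP[k /eqP ik]].
  by move: iuv => /orP[] /eqP; rewrite ik => /inj[_ /(congr1 val)].
have J1i b k : iota' b k \in J1 by rewrite inE; apply/existsP; exists b; apply/existsP; exists k.
(* [T'] is the sample space with only the events decided by the remaining coordinates; the identity
   into it plays the role of the conditioning variable. *)
pose T' := g_sigma_algebraType (cylinders _ _ _ _ X J1).
pose q (w : T') : R := qf _ _ M' (gvec n iota' w).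
pose c (w : T') : C := (l *m gvec n iota' w) ord0 ord0.
have mg k : cmeasurable _ _ T' (fun w => gvec n iota' w k ord0).
  exact: cmeasurable_gvec.
have mq : measurable_fun setT q by exact: measurable_qf.
have [mc1 mc2] : cmeasurable _ _ T' c by exact: cmeasurable_linear_form.
have iuv : iu != iv by apply/eqP => /inj[].
have induv A B : measurable A -> measurable B ->
    P (X iu @^-1` A `&` X iv @^-1` B) = (nu A * nu B)%E.
  move=> mA mB; rewrite -(lawX iu A mA) -(lawX iv B mB).
  have di i : i \in [set iu]%SET -> i \notin [set iv]%SET.
    by rewrite !inE => /eqP ->.
  apply: (cylinders_independent _ _ _ _ _ _ mX indX _ _ di).
    have := @measurable_cylinders _ _ _ _ X [set iu]%SET iu (set11 _) measurableT A mA.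
    by rewrite setTI.
  have := @measurable_cylinders _ _ _ _ X [set iv]%SET iv (set11 _) measurableT B mB.
  by rewrite setTI.
have indS (A : set T') (B : set (R * R)) : measurable A -> measurable B ->
    P (id @^-1` A `&` (fun w => (X iu w, X iv w)) @^-1` B) =
    (P (id @^-1` A) * P ((fun w => (X iu w, X iv w)) @^-1` B))%E.
  move=> mA mB; rewrite setIC muleC.
  apply: (cylinders_independent _ _ _ _ _ _ mX indX _ _ J01) => //.
  have m2 : measurable_fun (setT : set (g_sigma_algebraType (cylinders _ _ _ _ X J0)))
      (fun w => (X iu w, X iv w)).
    by apply: measurable_fun_pair; apply: measurable_cylinders; rewrite inE eqxx ?orbT.
  by have := m2 measurableT B mB; rewrite setTI.
have vecE w : gvec n.+1 iota w = col_mx (Complex (X iu w) (X iv w))%:M (gvec n iota' w).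
  apply/(@matrixP C (1 + n) 1) => i j; rewrite ord1; case: (@split_ordP 1 n i) => k ->.
    by rewrite col_mxEu !mxE ord1 /= mulr1n.
  by rewrite col_mxEd !mxE.
have QE w : qf _ _ M (gvec n.+1 iota w) =
    a * ((X iu w + complex.Re (c w)) ^+ 2 + (X iv w + complex.Im (c w)) ^+ 2) + q w.
  rewrite vecE qfE /nrm2 mxE /= mulr1n; congr (a * _ + _).
  by rewrite /c; case: ((l *m _) _ _).
(* [Kc * x] bounds both squared coordinates of the isolated entry, so its two density factors cost
   [expR (- (2 * (Kc * x)))]; [K] is inherited from the induction. *)
exists (2 * Kc + K); first by rewrite addr_ge0 ?mulr_ge0.
move=> x x0; under eq_set do rewrite QE.
have [-> mdisc] := @peel_gaussian_pair _ _ _ T T' P (X iu) (X iv) id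
  (fun w => complex.Re (c w)) (fun w => complex.Im (c w)) q a x (mX _) (mX _)
  (measurable_id_cylinders J1) mc1 mc2 mq induv indS a0.
have mqT : measurable_fun setT (q : T -> R).
  exact: (measurableT_comp mq (measurable_id_cylinders J1)).
have mmax : measurable_fun setT (fun w : T => (Num.max (x - q w) 0)%:E).
  apply/measurable_EFinP; apply: measurable_maxr => //; exact: measurable_funB.
have q0 w : 0 <= q w by exact: qf_ge0.
(* The sign is read off the induction hypothesis: at [x = 1] a probability is at most [D']. *)
have D'0 : 0 <= D'.
  have /andP[_] := hK 1 ltr01; rewrite expr1n mulr1 => h.
  by have := le_trans (measure_ge0 _ _) h; rewrite lee_fin.
have /andP[Elo Ehi] := positive_part_bounds _ _ _ P q n D' K mqT q0 D'0 K0 hK x x0.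
have max0 w : (0 <= (Num.max (x - q w) 0)%:E)%E by rewrite lee_fin le_max lexx orbT.
rewrite -/D; apply/andP; split; last first.
  apply: (@le_trans _ _ (\int[P]_w ((a^-1)%:E * (Num.max (x - q w) 0)%R%:E))%E).
    apply: ge0_le_integral => //=.
    - exact: emeasurable_funM.
    - move=> w _; have [t0|t0] := ltP 0 (x - q w).
        apply: le_trans (disc_prob_le _ _ _ _ _) _; first by rewrite divr_gt0.
        by rewrite -EFinM lee_fin mulrC.
      rewrite disc_eq0 ?measure0; last by rewrite pmulr_lle0 ?invr_gt0.
      by rewrite mule_ge0// lee_fin invr_ge0 ltW.
  rewrite ge0_integralZl//; last by rewrite lee_fin invr_ge0 ltW.
  rewrite DE -mulrA EFinM lee_wpmul2l//; first by rewrite lee_fin invr_ge0 ltW.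
pose e := expR (- (2 * (Kc * x))).
apply: (@le_trans _ _ (\int[P]_w ((e * a^-1)%:E * (Num.max (x - q w) 0)%R%:E))%E); last first.
  have ea0 : 0 <= e * a^-1 by rewrite mulr_ge0 ?expR_ge0 ?invr_ge0 ?ltW.
  apply: ge0_le_integral => //=.
  - by move=> w _; rewrite mule_ge0.
  - exact: emeasurable_funM.
  - move=> w _; have [t0|t0] := ltP 0 (x - q w); last first.
      by rewrite mule0.
    rewrite -EFinM -mulrA [a^-1 * _]mulrC.
    apply: disc_prob_ge; first by rewrite divr_gt0.
    move=> z; rewrite /disc/= ltr_pdivlMr// => zt.
    (* [z] is the integration variable, not the random entry. Completed by the remaining coordinates
       at [w], it has form value below [x], so coercivity bounds it. *)
    pose h := col_mx (Complex z.1 z.2)%:M (gvec n iota' w) : 'cV[C]_(1 + n).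
    have := hKc h; rewrite /h qfE => hz.
    suff : z.1 ^+ 2 + z.2 ^+ 2 <= Kc * x by have := sqr_ge0 z.1; have := sqr_ge0 z.2; split; lra.
    apply: (@le_trans _ _ (\sum_i nrm2 R (h i ord0))).
      rewrite (@big_split_ord _ _ _ 1 n) big_ord1 /= col_mxEu !mxE/= mulr1n /nrm2 /=.
      by rewrite lerDl sumr_ge0// => i _; exact: nrm2_ge0.
    apply: le_trans hz _; rewrite ler_wpM2l//.
    rewrite -/(c w) -/(q w) !mxE /= mulr1n /nrm2.
    by move: zt; case: (c w) => c1 c2 /=; lra.
rewrite ge0_integralZl//; last by rewrite lee_fin mulr_ge0 ?expR_ge0 ?invr_ge0 ?ltW.
apply: le_trans; last first.
  by apply: lee_wpmul2l Elo; rewrite lee_fin mulr_ge0 ?expR_ge0 ?invr_ge0 ?ltW.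
rewrite -EFinM lee_fin DE /e.
have -> : - ((2 * Kc + K) * x) = - (2 * (Kc * x)) - K * x by ring.
by rewrite expRD le_eqVlt; apply/orP; left; apply/eqP; ring.
Qed.
End small_ball.

(** * Tail of a product near zero *)

Section product_tail.
Context (R : realType) (d : measure_display) (T : measurableType d)
  (P : probability T R) (X Y : T -> R).
Hypotheses (mX : measurable_fun setT X) (mY : measurable_fun setT Y).
Hypothesis Y0 : forall w, 0 <= Y w.
Hypothesis indXY : forall A B : set R, measurable A -> measurable B ->
  P (X @^-1` A `&` Y @^-1` B) = (P (X @^-1` A) * P (Y @^-1` B))%E.

Let p (E : set T) : R := fine (P E).
Let F (x : R) := p [set w | X w < x].
Let G (x : R) := p [set w | Y w < x].

Let mlt (f : T -> R) (s : R) : measurable_fun setT f -> measurable [set w | f w < s].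
Proof. exact: measurable_lt_level. Qed.

Let mge (f : T -> R) (s : R) : measurable_fun setT f -> measurable [set w | s <= f w].
Proof.
move=> mf; rewrite (_ : [set w | _] = setT `&` f @^-1` `[s, +oo[); first exact: mf.
by rewrite setTI; apply/seteqP; split => w /=; rewrite in_itv/= andbT.
Qed.

Let mXY : measurable_fun setT (fun w => X w * Y w).
Proof. exact: measurable_funM. Qed.

Let p_ge0 E : 0 <= p E. Proof. exact: fine_ge0. Qed.

Let p_le A B : measurable A -> measurable B -> A `<=` B -> p A <= p B.
Proof.
by move=> mA mB AB; rewrite fine_le ?fin_num_measure//; apply: le_measure; rewrite ?inE.
Qed.

Let pU A B : measurable A -> measurable B -> A `&` B = set0 ->
  p (A `|` B) = p A + p B.
Proof.
by move=> mA mB AB; rewrite /p measureU// fineD ?fin_num_measure.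
Qed.

Let pI A B : measurable A -> measurable B ->
  p (X @^-1` A `&` Y @^-1` B) = p (X @^-1` A) * p (Y @^-1` B).
Proof.
have m (f : T -> R) (E : set R) : measurable_fun setT f -> measurable E -> measurable (f @^-1` E).
  by move=> mf mE; rewrite -(setTI (f @^-1` E)); exact: mf.
by move=> mA mB; rewrite /p indXY// fineM//; apply: fin_num_measure; exact: m.
Qed.

Let slice (t a b : R) := [set w | X w * Y w < t] `&` ([set w | a <= X w] `&` [set w | X w < b]).

Let mslice t a b : measurable (slice t a b).
Proof. by apply: measurableI; [exact: mlt|apply: measurableI; [exact: mge|exact: mlt]]. Qed.

Let box (a b y : R) : p (([set w | a <= X w] `&` [set w | X w < b]) `&` [set w | Y w < y]) =
  p ([set w | a <= X w] `&` [set w | X w < b]) * G y.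
Proof.
have -> : [set w | a <= X w] `&` [set w | X w < b] = X @^-1` `[a, b[.
  by apply/seteqP; split => w /=; rewrite in_itv/= => /andP.
have -> : [set w | Y w < y] = Y @^-1` `]-oo, y[.
  by apply/seteqP; split => w /=; rewrite in_itv.
by rewrite pI.
Qed.

Let band (a b : R) : a <= b -> p ([set w | a <= X w] `&` [set w | X w < b]) = F b - F a.
Proof.
move=> ab; suff -> : F b = F a + p ([set w | a <= X w] `&` [set w | X w < b]).
  by rewrite addrAC subrr add0r.
rewrite /F -pU; last 3 first.
- exact: mlt.
- by apply: measurableI; [exact: mge|exact: mlt].
- by rewrite -subset0 => w /= [] /lt_le_trans h [] /h; rewrite ltxx.
congr p; apply/seteqP; split => w /=; last by case=> [/lt_le_trans|[]//]; apply.
by have [|] := ltP (X w) a; [left|right].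
Qed.

(** For [a <= X < b], [Y < t / b] forces [X Y < t], which in turn forces [Y < t / a]. When [a = q b]
    the lower and upper bounds differ by [q ^- N] at leading order. *)
Let slice_ge (t a b : R) : 0 < a -> a < b -> (F b - F a) * G (t / b) <= p (slice t a b).
Proof.
move=> a0 ab; have b0 := lt_trans a0 ab.
rewrite -(band _ _ (ltW ab)) -box; apply: p_le => //.
  by apply: measurableI; [apply: measurableI; [exact: mge|exact: mlt]|exact: mlt].
move=> w /= [[aX Xb] Yt]; split => //=.
rewrite (le_lt_trans (ler_wpM2r (Y0 w) (ltW Xb)))//.
by move: Yt; rewrite ltr_pdivlMr// mulrC.
Qed.

Let slice_le (t a b : R) : 0 < a -> a < b -> p (slice t a b) <= (F b - F a) * G (t / a).
Proof.
move=> a0 ab; have b0 := lt_trans a0 ab.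
rewrite -(band _ _ (ltW ab)) -box; apply: p_le => //.
  by apply: measurableI; [apply: measurableI; [exact: mge|exact: mlt]|exact: mlt].
move=> w /= [XYt [aX Xb]]; split => //=.
by rewrite ltr_pdivlMr// mulrC (le_lt_trans _ XYt)// ler_wpM2r.
Qed.

Variables (N : nat) (al be K1 K2 : R).
Hypotheses (al0 : 0 <= al) (be0 : 0 <= be) (K10 : 0 <= K1) (K20 : 0 <= K2).
Hypothesis HF : forall x, 0 < x -> al * expR (- (K1 * x)) * x ^+ N <= F x <= al * x ^+ N.
Hypothesis HG : forall x, 0 < x -> be * expR (- (K2 * x)) * x ^+ N <= G x <= be * x ^+ N.

(* [1 - expR (- x) <= x] makes the per-slice errors geometric, hence summable. *)
Let W (q t : R) (m : nat) := p ([set w | X w * Y w < t] `&` [set w | q ^+ m <= X w]).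

Let WS (q t : R) m : 0 < q -> q < 1 ->
  W q t m.+1 = W q t m + p (slice t (q ^+ m.+1) (q ^+ m)).
Proof.
move=> q0 q1; rewrite /W -pU; last 3 first.
- by apply: measurableI; [exact: mlt|exact: mge].
- exact: mslice.
- by rewrite -subset0 => w /= [] [_ h] [_ [_ /(le_lt_trans h)]]; rewrite ltxx.
congr p; apply/seteqP; split => w /=.
  by case=> XYt qX; have [|] := leP (q ^+ m) (X w); [left|right].
case=> [[XYt qX]|[XYt [? ?]]] //; split => //; apply: le_trans qX.
by rewrite exprS ler_piMl ?exprn_ge0// ltW.
Qed.

(** On [[q x, x[] the factors [x^N (1 - q^N)] and [(t / x)^N] have a product free of [x]. The errors
    [K1 x] and [K2 t / x], taken at the successive powers of [q], give the two geometric sums. *)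
Let W_ge (q t : R) m : 0 < q -> q < 1 -> 0 < t ->
  al * be * t ^+ N * (m%:R * (1 - q ^+ N) - K1 * ((1 - q ^+ m) / (1 - q))
    - K2 * t * ((q ^- m - 1) * q / (1 - q))) <= W q t m.
Proof.
move=> q0 q1 t0; elim: m => [|m IH].
  rewrite expr0 invr1 !subrr !mul0r !mulr0 !subr0 mulr0; exact: p_ge0.
rewrite WS//; set x := q ^+ m; have x0 : 0 < x by exact: exprn_gt0.
have x1 : q ^+ m.+1 = q * x by rewrite exprS.
have step : al * be * t ^+ N * (1 - q ^+ N - K1 * x - K2 * t / x) <=
    p (slice t (q ^+ m.+1) x).
  apply: le_trans (slice_ge _ _ _ _ _); last 2 first.
  - exact: exprn_gt0.
  - by rewrite x1 gtr_pMl.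
  have /andP[Fx _] := HF x x0.
  have /andP[_ Fqx] := HF (q ^+ m.+1) (exprn_gt0 _ q0).
  have /andP[Gx _] := HG (t / x) (divr_gt0 t0 x0).
  set e1 := expR (- (K1 * x)) in Fx; set e2 := expR (- (K2 * (t / x))) in Gx.
  have e1ge : 1 - K1 * x <= e1 by exact: expR_ge1Dx.
  have e2ge : 1 - K2 * (t / x) <= e2 by exact: expR_ge1Dx.
  have e1le : e1 <= 1 by rewrite -expR0 ler_expR oppr_le0 mulr_ge0// ltW.
  have e2le : e2 <= 1 by rewrite -expR0 ler_expR oppr_le0 mulr_ge0// divr_ge0// ltW.
  have e10 : 0 <= e1 by exact: expR_ge0.
  have e20 : 0 <= e2 by exact: expR_ge0.
  have FF : al * x ^+ N * (e1 - q ^+ N) <= F x - F (q ^+ m.+1).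
    move: Fqx; rewrite x1 exprMn => Fqx.
    apply: (le_trans _ (lerB Fx Fqx)); rewrite le_eqVlt; apply/orP; left; apply/eqP; ring.
  have GG : be * e2 * (t / x) ^+ N <= G (t / x) by [].
  have Kt0 : 0 <= K2 * (t / x) by rewrite mulr_ge0// divr_ge0// ltW.
  have KtE : K2 * t / x = K2 * (t / x) by rewrite mulrA.
  have C0 : 0 <= al * be * t ^+ N by rewrite !mulr_ge0 ?exprn_ge0// ltW.
  have FFn : 0 <= F x - F (q ^+ m.+1).
    by rewrite subr_ge0; apply: p_le; [exact: mlt|exact: mlt|move=> w /= /lt_trans; apply; rewrite x1 gtr_pMl].
  (* If [e1 < q ^+ N], then [1 - K1 x <= e1] makes the claimed lower bound nonpositive, hence
     trivial. *)
  have [eq0|eq0] := leP 0 (e1 - q ^+ N); last first.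
    apply: (@le_trans _ _ 0); last by apply: mulr_ge0 => //; exact: p_ge0.
    by rewrite mulr_ge0_le0//; lra.
  apply: (@le_trans _ _ (al * x ^+ N * (e1 - q ^+ N) * (be * e2 * (t / x) ^+ N))); last first.
    apply: ler_pM => //; first by rewrite !mulr_ge0 ?exprn_ge0// ltW.
    by rewrite !mulr_ge0 ?exprn_ge0// divr_ge0// ltW.
  have -> : al * x ^+ N * (e1 - q ^+ N) * (be * e2 * (t / x) ^+ N) =
     al * be * t ^+ N * (e2 * (e1 - q ^+ N)).
    by rewrite expr_div_n; field; rewrite expf_neq0// gt_eqF.
  rewrite ler_wpM2l// KtE.
  have qN0 : 0 <= q ^+ N by rewrite exprn_ge0 ?ltW.
  (* Expanded, this gives [e2 (e1 - q^N) >= e1 + e2 - 1 - q^N], so the two errors become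
     additive. *)
  have : 0 <= (1 - e2) * (1 - (e1 - q ^+ N)) by apply: mulr_ge0; lra.
  lra.
apply: le_trans (lerD IH step).
rewrite le_eqVlt; apply/orP; left; apply/eqP.
rewrite -natr1 exprS -/x; field.
by rewrite !gt_eqF// subr_gt0.
Qed.

(** The term [be * t ^+ N] covers [X >= 1], where [Y < t]. The factor [q ^- N] comes from estimating
    [Y] at the lower end of each slice. *)
Let W_le (q t : R) m : 0 < q -> q < 1 -> 0 < t ->
  W q t m <= be * t ^+ N + al * be * t ^+ N * q ^- N *
     (m%:R * (1 - q ^+ N) + K1 * ((1 - q ^+ m) / (1 - q))).
Proof.
move=> q0 q1 t0; elim: m => [|m IH].
  rewrite expr0 subrr !mul0r !mulr0 addr0 mulr0 addr0.
  have /andP[_ +] := HG t t0; apply: le_trans; apply: p_le => //.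
  - by apply: measurableI; [exact: mlt|exact: mge].
  - exact: mlt.
  - move=> w /= [XYt]; rewrite expr0 => X1; apply: le_lt_trans XYt.
    by rewrite ler_peMl.
rewrite WS//; set x := q ^+ m; have x0 : 0 < x by exact: exprn_gt0.
have x1 : q ^+ m.+1 = q * x by rewrite exprS.
have step : p (slice t (q ^+ m.+1) x) <=
    al * be * t ^+ N * q ^- N * (1 - q ^+ N + K1 * x).
  apply: le_trans (slice_le _ _ _ _ _) _.
  - exact: exprn_gt0.
  - by rewrite x1 gtr_pMl.
  rewrite x1; have y0 : 0 < q * x by exact: mulr_gt0.
  have /andP[_ Fx] := HF x x0.
  have /andP[Fqx _] := HF (q * x) y0.
  have /andP[_ Gx] := HG (t / (q * x)) (divr_gt0 t0 y0).
  set e1 := expR (- (K1 * (q * x))) in Fqx.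
  have e1ge : 1 - K1 * (q * x) <= e1 by exact: expR_ge1Dx.
  have e1le : e1 <= 1 by rewrite -expR0 ler_expR oppr_le0 mulr_ge0// ltW.
  have FFn : 0 <= F x - F (q * x).
    by rewrite subr_ge0; apply: p_le; [exact: mlt|exact: mlt|move=> w /= /lt_trans; apply; rewrite gtr_pMl].
  have FF : F x - F (q * x) <= al * x ^+ N * (1 - q ^+ N * e1).
    move: Fqx; rewrite exprMn => Fqx.
    apply: (le_trans (lerB Fx Fqx)); rewrite le_eqVlt; apply/orP; left; apply/eqP; ring.
  apply: (@le_trans _ _ (al * x ^+ N * (1 - q ^+ N * e1) * (be * (t / (q * x)) ^+ N))).
    by apply: ler_pM => //; exact: p_ge0.
  have -> : al * x ^+ N * (1 - q ^+ N * e1) * (be * (t / (q * x)) ^+ N) =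
    al * be * t ^+ N * q ^- N * (1 - q ^+ N * e1).
    by rewrite expr_div_n exprMn; field; rewrite !expf_neq0// gt_eqF.
  rewrite ler_wpM2l//; first by rewrite !mulr_ge0 ?invr_ge0 ?exprn_ge0// ltW.
  have qN0 : 0 <= q ^+ N by rewrite exprn_ge0 ?ltW.
  have qN1 : q ^+ N <= 1 by rewrite exprn_ile1 ?ltW.
  have K1x : 0 <= K1 * x by rewrite mulr_ge0// ltW.
  have : q ^+ N * (1 - K1 * (q * x)) <= q ^+ N * e1 by rewrite ler_wpM2l.
  have : q ^+ N * q * (K1 * x) <= K1 * x.
    by rewrite ler_piMl// mulr_ile1// ltW.
  lra.
apply: le_trans (lerD IH step) _.
rewrite le_eqVlt; apply/orP; left; apply/eqP.
rewrite -natr1 exprS -/x; field.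
by rewrite expf_neq0 ?gt_eqF// subr_gt0.
Qed.

Lemma product_tail (h : R) : 0 < h -> exists C : R, forall t, 0 < t < 1 ->
  t ^+ N * (al * be * N%:R * expR (- (N%:R * h)) * - ln t - C) <=
    fine (P [set w | X w * Y w < t]) <=
  t ^+ N * (al * be * N%:R * expR (N%:R * h) * - ln t + C).
Proof.
move=> h0; have [q qE] : exists q, q = expR (- h) by exists (expR (- h)).
have q0 : 0 < q by rewrite qE expR_gt0.
have q1 : q < 1 by rewrite qE -expR0 ltr_expR oppr_lt0.
have qX n : q ^+ n = expR (- (n%:R * h)) by rewrite qE -expRM_natl mulrN.
have iq0 : 0 <= (1 - q)^-1 by rewrite invr_ge0 subr_ge0 ltW.
(* The 1 pays for rounding [L / h] to an integer, the rest for the two geometric sums. *)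
have [C1 C1E] : exists C1, C1 = al * be * (1 + (K1 + K2) / (1 - q)) by eexists.
(* [al] pays for the leftover values of [X] near 0, [be] for [X >= 1], the last term for rounding
   and the geometric sum. *)
have [C2 C2E] : exists C2,
  C2 = al + be + al * be * expR (N%:R * h) * (1 + K1 / (1 - q)) by eexists.
have ab0 : 0 <= al * be by rewrite mulr_ge0.
have C10 : 0 <= C1 by rewrite C1E mulr_ge0// addr_ge0// mulr_ge0// addr_ge0.
have C20 : 0 <= C2.
  rewrite C2E; by rewrite !addr_ge0// mulr_ge0 ?addr_ge0 ?mulr_ge0 ?expR_ge0.
exists (C1 + C2) => t /andP[t0 t1].
have tN0 : 0 <= t ^+ N by rewrite exprn_ge0 ?ltW.
have [L LE] : exists L, L = - ln t by eexists.
rewrite -LE; have L0 : 0 < L by rewrite LE oppr_gt0 ln_lt0// t0.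
have tL : t = expR (- L) by rewrite LE opprK lnK.
have Lh0 : 0 <= L / h by rewrite divr_ge0// ltW.
(* This [n] gives [q ^+ n.+1 <= t <= q ^+ n]. Stopping at [n] slices keeps [K2 t q ^- n] bounded in
   the lower bound; one more slice makes the leftover [X < q ^+ n.+1] of order [t ^+ N] in the upper
   one. *)
have [n [nL Ln]] : exists n : nat, n%:R <= L / h /\ L / h < n.+1%:R.
  by exists (Num.truncn (L / h)); rewrite truncn_le truncnS_gt.
have nhL : n%:R * h <= L by rewrite -ler_pdivlMr.
have Lnh : L < n.+1%:R * h by rewrite -ltr_pdivrMr.
have tqn : t <= q ^+ n by rewrite qX {1}tL ler_expR lerN2.
have qnt : q ^+ n.+1 <= t by rewrite qX {1}tL ler_expR lerN2 ltW.
have [u uE] : exists u, u = N%:R * h by eexists.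
have [e eq] : exists e, e = q ^+ N by eexists.
rewrite -uE; have u0 : 0 <= u by rewrite uE mulr_ge0// ltW.
have eE : e = expR (- u) by rewrite eq qX uE.
have e0 : 0 <= e by rewrite eE expR_ge0.
have eu : e * expR u = 1 by rewrite eE -expRD addNr expR0.
(* From [u e^-u <= 1 - e^-u <= u], the quantity [(L / h) (1 - q^N)] lies between [e^-u N L] and
   [N L]. *)
have e_ub : 1 - e <= u by have := expR_ge1Dx (- u); rewrite -eE; lra.
have e_lb : u * e <= 1 - e.
  have := expR_ge1Dx u => h1; have := ler_wpM2l e0 h1; rewrite eu; lra.
have uh : u / h = N%:R by rewrite uE mulfK ?gt_eqF.
have qn0 : 0 < q ^+ n by exact: exprn_gt0.
have mXYt : measurable [set w | X w * Y w < t] by exact: mlt.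
apply/andP; split.
  apply: (@le_trans _ _ (W q t n)); last first.
    by apply: p_le => //; apply: measurableI => //; exact: mge.
  apply: le_trans (W_ge _ _ _ q0 q1 t0); rewrite -eq.
  have h1 : N%:R * e * L - 1 <= n%:R * (1 - e).
    have : (L / h - 1) * (1 - e) <= n%:R * (1 - e).
      by rewrite ler_wpM2r//; [have := mulr_ge0 u0 e0; lra|move: Ln; rewrite -natr1; lra].
    have : L / h * (u * e) <= L / h * (1 - e) by rewrite ler_wpM2l.
    have -> : L / h * (u * e) = N%:R * e * L by rewrite -uh; field; rewrite gt_eqF.
    lra.
  have h2 : K1 * ((1 - q ^+ n) / (1 - q)) <= K1 / (1 - q).
    by rewrite ler_wpM2l// ler_piMl//; lra.
  have h3 : K2 * t * ((q ^- n - 1) * q / (1 - q)) <= K2 / (1 - q).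
    rewrite -[K2 * t * _]mulrA ler_wpM2l// !mulrA ler_piMl//.
    have tq1 : t * q ^- n <= 1 by rewrite ler_pdivrMr// mul1r.
    have tq0 : 0 <= t * (q ^- n - 1).
      by apply: mulr_ge0; [exact: ltW|rewrite subr_ge0 invf_ge1//; apply: exprn_ile1; exact: ltW].
    apply: (@le_trans _ _ (t * (q ^- n - 1))); first by rewrite ler_piMr// ltW.
    by rewrite mulrBr mulr1; lra.
  apply: (@le_trans _ _ (al * be * t ^+ N * (N%:R * e * L - 1 - K1 / (1 - q) - K2 / (1 - q)))).
    have -> : al * be * t ^+ N * (N%:R * e * L - 1 - K1 / (1 - q) - K2 / (1 - q)) =
      t ^+ N * (al * be * N%:R * e * L - C1) by rewrite C1E; ring.
    by rewrite ler_wpM2l// -eE; lra.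
  by rewrite ler_wpM2l ?mulr_ge0//; lra.
apply: (@le_trans _ _ (W q t n.+1 + F (q ^+ n.+1))).
  rewrite -pU; last 3 first.
  - by apply: measurableI => //; exact: mge.
  - exact: mlt.
  - by rewrite -subset0 => w /= [] [_ /le_lt_trans hh] /hh; rewrite ltxx.
  apply: p_le => //.
    by apply: measurableU; [apply: measurableI => //; exact: mge|exact: mlt].
  by move=> w /= XYt; have [|] := leP (q ^+ n.+1) (X w); [left|right].
have hF : F (q ^+ n.+1) <= al * t ^+ N.
  have /andP[_ hF] := HF (q ^+ n.+1) (exprn_gt0 _ q0).
  apply: le_trans hF _; rewrite ler_wpM2l// lerXn2r// nnegrE ltW//.
  exact: exprn_gt0.
apply: le_trans (lerD (W_le _ _ _ q0 q1 t0) hF) _; rewrite -eq.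
have h1 : n.+1%:R * (1 - e) <= N%:R * L + 1.
  have : n.+1%:R * (1 - e) <= (L / h + 1) * (1 - e).
    by rewrite ler_wpM2r//; [have := mulr_ge0 u0 e0; lra|move: nL; rewrite -natr1; lra].
  have : L / h * (1 - e) <= L / h * u by rewrite ler_wpM2l.
  have -> : L / h * u = N%:R * L by rewrite -uh; field; rewrite gt_eqF.
  lra.
have h2 : K1 * ((1 - q ^+ n.+1) / (1 - q)) <= K1 / (1 - q).
  by rewrite ler_wpM2l// ler_piMl//; have := exprn_gt0 n.+1 q0; lra.
have eV : e^-1 = expR u by rewrite eE -expRN opprK.
rewrite eV.
apply: (@le_trans _ _ (be * t ^+ N + al * be * t ^+ N * expR u * (N%:R * L + 1 + K1 / (1 - q)) + al * t ^+ N)).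
  rewrite lerD2r lerD2l ler_wpM2l//; first by rewrite !mulr_ge0 ?expR_ge0.
  by lra.
have -> : be * t ^+ N + al * be * t ^+ N * expR u * (N%:R * L + 1 + K1 / (1 - q)) + al * t ^+ N
  = t ^+ N * (al * be * N%:R * expR u * L + C2) by rewrite C2E -uE; ring.
by rewrite ler_wpM2l//; lra.
Qed.
End product_tail.

(** * Lagrange interpolation and the limit of a logarithmic ratio *)

(** The polynomial of degree below [N] with value 1 at all [N] nodes is the constant 1. Evaluating
    its Lagrange form at 0 produces the products of [- lam j] over [j != i], that is [(-1)^(N-1)]
    times the full product over [lam i]. *)
Lemma lagrange_at_zero (F : fieldType) (N : nat) (lam : 'I_N -> F) :
  (0 < N)%N -> injective lam -> (forall k, lam k != 0) ->
  \sum_i (lam i)^-1 / \prod_(j | j != i) (lam i - lam j) =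
  (-1) ^+ N.-1 / \prod_i lam i.
Proof.
move=> N0 inj lam0.
pose c i := \prod_(j | j != i) (lam i - lam j).
have c0 i : c i != 0.
  apply/prodf_neq0 => j ji; rewrite subr_eq0; apply: contra ji => /eqP/inj ->.
  exact: eqxx.
pose p : {poly F} := \sum_i (c i)^-1 *: \prod_(j | j != i) ('X - (lam j)%:P).
have card_neq (i : 'I_N) : #|[pred j | j != i]| = N.-1.
  by have := cardC1 i; rewrite card_ord => <-; apply: eq_card => j; rewrite !inE.
have szp : (size (p - 1)%R <= N)%N.
  rewrite (leq_trans (size_polyD _ _))// geq_max size_polyN size_poly1 N0 andbT.
  apply: (leq_trans (size_sum _ _ _)); apply/bigmax_leqP => i _.
  apply: leq_trans (size_scale_leq _ _) _.
  rewrite size_prod; last by move=> j _; rewrite polyXsubC_eq0.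
  under eq_bigr do rewrite size_XsubC.
  by rewrite sum_nat_const card_neq muln2 -addnn -addSn addnK prednK.
have pk k : p.[lam k] = 1.
  rewrite /p horner_sum (bigD1 k)//= hornerZ horner_prod [X in _ + X]big1 ?addr0.
    under eq_bigr do rewrite hornerXsubC.
    by rewrite mulVf.
  move=> i ik; rewrite hornerZ horner_prod (bigD1 k) 1?eq_sym//=.
  by rewrite hornerXsubC subrr mul0r mulr0.
have p1 : p = 1.
  apply/eqP; rewrite -subr_eq0; apply/eqP.
  apply: (@roots_geq_poly_eq0 _ _ [seq lam k | k <- enum 'I_N]).
  - by apply/allP => _ /mapP[k _ ->]; rewrite rootE hornerD hornerN hornerC pk subrr.
  - by rewrite map_inj_uniq ?enum_uniq.
  - by rewrite size_map size_enum_ord.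
have E := congr1 (fun r : {poly F} => r.[0]) p1; rewrite /= hornerC /p horner_sum in E.
have L0 : \prod_i lam i != 0 by apply/prodf_neq0 => i _.
rewrite -[RHS]mulr1; move: E => /esym E; rewrite [X in _ * X]E mulr_sumr.
apply: eq_bigr => i _.
rewrite hornerZ horner_prod.
have -> : \prod_(j | j != i) ('X - (lam j)%:P).[0] = (-1) ^+ N.-1 * \prod_(j | j != i) lam j.
  under eq_bigr do rewrite hornerXsubC sub0r -mulN1r.
  by rewrite big_split/= prodr_const card_neq.
have -> : \prod_i lam i = lam i * \prod_(j | j != i) lam j by rewrite (bigD1 i).
have Li : \prod_(j | j != i) lam j != 0 by apply/prodf_neq0 => j _.
rewrite -/(c i).
have s1 : (-1) ^+ N.-1 * (-1) ^+ N.-1 = 1 :> F by rewrite -exprMn mulrNN mulr1 expr1n.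
set s := (-1) ^+ N.-1 in s1 *.
transitivity (s * s * ((lam i)^-1 / c i)); first by rewrite s1 mul1r.
by field; rewrite Li lam0 c0.
Qed.

Section ratio_limit.
Context (R : realType).
(** [C] and [r0] may depend on [e]: it is tuned to the tolerance alone, and then every constant is
    negligible against [ln r]. *)
Lemma log_ratio_limit (f : R -> R) (c C0 : R) : 0 < c ->
  (forall e, 0 < e -> exists C r0 : R, forall r, r0 <= r ->
     c * expR (- e) * ln r - C <= f r <= c * expR e * ln r + C) ->
  f r / (c * ln r + C0) @[r --> +oo] --> (1 : R).
Proof.
move=> c0 H; apply/cvgrPdist_le => /= eta eta0.
(* Half of the tolerance goes to the factors [expR e] and [expR (- e)], half to the bounded
   terms. *)
pose e := ln (1 + eta / 2).
have e1 : 0 < 1 + eta / 2 by lra.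
have e0 : 0 < e by rewrite ln_gt0//; lra.
have Ee : expR e = 1 + eta / 2 by rewrite lnK.
have En : 1 - eta / 2 <= expR (- e).
  rewrite expRN Ee -[leRHS]mul1r ler_pdivlMr//.
  by have := sqr_ge0 (eta / 2); rewrite expr2; lra.
have [C [r0 HC]] := H e e0.
(* The first summand makes [|C| + (1 + eta) |C0|] at most [c ln r * eta / 2]; the second makes the
   denominator at least 1. *)
pose L := 2 * (`|C| + (1 + eta) * `|C0|) / (c * eta) + (`|C0| + 1) / c.
near=> r.
have rr0 : r0 <= r by near: r; apply: nbhs_pinfty_ge; exact: num_real.
have rL : expR L <= r by near: r; apply: nbhs_pinfty_ge; exact: num_real.
have lL : L <= ln r.
  by rewrite -[L]expRK ler_ln// ?posrE ?expR_gt0// (lt_le_trans (expR_gt0 L) rL).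
have /andP[lo hi] := HC r rr0.
set l := ln r in lL lo hi *.
have C0n := ler_norm C0; have C0n' := ler_norm (- C0); have Cn := ler_norm C.
rewrite normrN in C0n'.
have n0 := normr_ge0 C0; have n1 := normr_ge0 C.
have A0 : 0 <= 2 * (`|C| + (1 + eta) * `|C0|) / (c * eta).
  by rewrite divr_ge0 ?mulr_ge0 ?addr_ge0 ?mulr_ge0//; lra.
have B0 : 0 <= (`|C0| + 1) / c by rewrite divr_ge0 ?addr_ge0// ltW.
have l1 : `|C0| + 1 <= c * l.
  by rewrite mulrC -ler_pdivrMr//; apply: le_trans lL; rewrite /L; lra.
have l2 : `|C| + (1 + eta) * `|C0| <= c * l * (eta / 2).
  have : 2 * (`|C| + (1 + eta) * `|C0|) / (c * eta) <= l.
    by apply: le_trans lL; rewrite /L; lra.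
  by rewrite ler_pdivrMr ?mulr_gt0//; lra.
have g0 : 0 < c * l + C0 by lra.
rewrite -[X in X - _](divff (lt0r_neq0 g0)) -mulrBl normrM [X in _ * X]gtr0_norm ?invr_gt0//.
rewrite ler_pdivrMr//.
have etaC : eta * C0 <= eta * `|C0| by rewrite ler_wpM2l// ltW.
have etaC' : eta * - C0 <= eta * `|C0| by rewrite ler_wpM2l// ltW.
have cl0 : 0 <= c * l by lra.
have hi' : c * l * expR e = c * l + c * l * (eta / 2) by rewrite Ee; ring.
have lo' : c * l * (1 - eta / 2) <= c * l * expR (- e) by rewrite ler_wpM2l.
rewrite ler_norml; apply/andP; split; lra.
Unshelve. all: by end_near.
Qed.
End ratio_limit.

(** * Expansion of [A_asym] in [ln rho] *)

Section asymptotics.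
Context (R : realType).

Definition leading_coef (N : nat) (lam sig : 'I_N -> R) (eta theta d1 d2 tau gth : R) : R :=
  (gth * d1 `^ tau * (d2 `^ tau / (eta * theta))) ^+ N *
  (N`!%:R * N.-1`!%:R * \prod_i lam i * \prod_i sig i)^-1.

(** Once [ln rho] is split off the logarithm, its coefficient factors into two Lagrange sums, whose
    signs [(-1)^(N-1)] cancel. *)
Lemma A_asymE N (lam sig : 'I_N -> R) (eta theta d1 d2 tau gth : R) :
  (0 < N)%N -> theta < 1 -> 0 < d1 -> 0 < gth ->
  (forall k, 0 < lam k) -> (forall k, 0 < sig k) ->
  injective lam -> injective sig ->
  exists C0 : R, forall rho, 0 < rho ->
    A_asym lam sig eta theta d1 d2 tau gth rho =
    (leading_coef N lam sig eta theta d1 d2 tau gth * ln rho + C0) / rho ^+ N.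
Proof.
move=> N0 th1 d10 g0 lam0 sig0 injl injs.
pose D1 := d1 `^ tau; have D10 : 0 < D1 by exact: powR_gt0.
pose u (i : 'I_N) := (lam i)^-1 / \prod_(j < N | j != i) (lam i - lam j).
pose v (m : 'I_N) := (sig m)^-1 / \prod_(n < N | n != m) (sig m - sig n).
pose B : R := ((N.-1)`!%:R)^-1 * (d2 `^ tau / (eta * theta)) ^+ N.
pose k (i : 'I_N) : R := Defs.harmonic N.-1 - euler_mascheroni +
  ln ((1 - theta) * lam i / (gth * D1)).
pose s (m : 'I_N) : R := (- sig m / (1 - theta)) ^+ N.
exists ((gth * D1) ^+ N * \sum_i \sum_m u i * v m * (N`!%:R)^-1 * (B * k i - s m)).
move=> rho r0.
have uv : (\sum_i u i) * (\sum_m v m) = (\prod_i lam i * \prod_i sig i)^-1.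
  rewrite !lagrange_at_zero//; try by [move=> i; rewrite gt_eqF].
  by rewrite mulrACA -exprMn mulrNN mulr1 expr1n mul1r invfM.
have -> : leading_coef N lam sig eta theta d1 d2 tau gth =
    (gth * D1) ^+ N * ((N`!%:R)^-1 * B * ((\sum_i u i) * (\sum_m v m))).
  rewrite uv /leading_coef /B -/D1 exprMn.
  move: ((d2 `^ tau / (eta * theta)) ^+ N) => x2; rewrite !invfM.
  move: ((gth * D1) ^+ N) (N`!%:R^-1) (N.-1`!%:R^-1)
    ((\prod_i lam i)^-1) ((\prod_i sig i)^-1) => x1 x3 x4 x5 x6; clear; ring.
transitivity (((gth * D1) / rho) ^+ N *
    (\sum_i \sum_m u i * v m * (N`!%:R)^-1 * (B * (k i + ln rho) - s m))).
  rewrite mulr_sumr; apply: eq_bigr => i _; rewrite mulr_sumr; apply: eq_bigr => m _.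
  rewrite -/D1 -/(u i) -/(v m) -/(s m) -/B /k.
  have -> : ln ((1 - theta) * rho * lam i / (gth * D1)) =
      ln ((1 - theta) * lam i / (gth * D1)) + ln rho.
    rewrite -lnM ?posrE//; last first.
      by rewrite divr_gt0 ?mulr_gt0// subr_gt0.
    by congr ln; ring.
  rewrite addrA mulrC; congr (_ * _).
rewrite expr_div_n.
have -> : \sum_i \sum_m u i * v m * (N`!%:R)^-1 * (B * (k i + ln rho) - s m) =
    \sum_i \sum_m u i * v m * (N`!%:R)^-1 * (B * k i - s m) +
    (N`!%:R)^-1 * B * ((\sum_i u i) * (\sum_m v m)) * ln rho.
  rewrite big_distrlr/= mulr_sumr mulr_suml -big_split; apply: eq_bigr => i _ /=.
  rewrite mulr_sumr mulr_suml -big_split; apply: eq_bigr => m _ /=.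
  move: (u i) (v m) (N`!%:R^-1) (k i) (s m) B (ln rho) => x1 x2 x3 x4 x5 x6 x7.
  clear; ring.
move: (\sum_i \sum_m _) ((N`!%:R)^-1 * B * _) ((gth * D1) ^+ N) (rho ^- N) (ln rho).
by clear => x1 x2 x3 x4 x5; ring.
Qed.

End asymptotics.

(** * The outage event *)

Section outage.
Context (R : realType).

(** The denominator is at least 1 and can be cleared; splitting the exponent [2 * tau] identifies
    the coefficient of the numerator with [a * b]. *)
Lemma gammaI_ltE (eta theta d1 d2 tau rho x y g : R) :
  0 < eta -> 0 < theta -> theta < 1 -> 0 < d1 -> 0 < d2 -> 0 < rho ->
  0 <= x -> 0 <= y ->
  let a := eta * theta / (d1 `^ tau * d2 `^ tau) * rho in
  let b := (1 - theta) / d1 `^ tau * rho in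
  (gammaI eta theta d1 d2 tau rho x y < g) =
  (a * b * y * x ^+ 2 < g * (a * y * x + b * x + 1)).
Proof.
move=> e0 t0 t1 d10 d20 r0 x0 y0 a b; rewrite /gammaI.
have D10 : 0 < d1 `^ tau by exact: powR_gt0.
have D20 : 0 < d2 `^ tau by exact: powR_gt0.
have -> : d1 `^ (2 * tau) = d1 `^ tau * d1 `^ tau.
  have -> : 2 * tau = tau + tau by ring.
  by rewrite powRD//; apply/implyP => _; rewrite gt_eqF.
have a0 : 0 < a by rewrite mulr_gt0 ?divr_gt0 ?mulr_gt0.
have b0 : 0 < b by rewrite mulr_gt0 ?divr_gt0 ?subr_gt0.
have -> : eta * theta * rho / (d1 `^ tau * d2 `^ tau) = a by rewrite /a mulrAC.
have -> : (1 - theta) * rho / d1 `^ tau = b by rewrite /b mulrAC.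
have ayx : 0 <= a * y * x by exact: mulr_ge0 (mulr_ge0 (ltW a0) y0) x0.
have bx : 0 <= b * x by exact: mulr_ge0 (ltW b0) x0.
rewrite ltr_pdivrMr; last by rewrite ltr_wpDl// addr_ge0.
congr (_ * _ * _ < _); rewrite /a /b.
move: (d1 `^ tau) (d2 `^ tau) D10 D20 => D1 D2 D10 D20.
by field; rewrite !gt_eqF.
Qed.

Context (d : measure_display) (T : measurableType d) (P : probability T R).
Variables (X Y : T -> R).
Hypotheses (mX : measurable_fun setT X) (mY : measurable_fun setT Y).
Hypotheses (X0 : forall w, 0 <= X w) (Y0 : forall w, 0 <= Y w).
Hypothesis indXY : forall A B : set R, measurable A -> measurable B ->
  P (X @^-1` A `&` Y @^-1` B) = (P (X @^-1` A) * P (Y @^-1` B))%E.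
Variables (N : nat) (al be K1 K2 : R).
Hypothesis N0 : (0 < N)%N.
Hypotheses (al0 : 0 <= al) (be0 : 0 <= be) (K10 : 0 <= K1) (K20 : 0 <= K2).
Hypothesis HF : forall x, 0 < x ->
  al * expR (- (K1 * x)) * x ^+ N <= fine (P [set w | X w < x]) <= al * x ^+ N.
Hypothesis HG : forall x, 0 < x ->
  be * expR (- (K2 * x)) * x ^+ N <= fine (P [set w | Y w < x]) <= be * x ^+ N.

Let mlt (f : T -> R) (s : R) : measurable_fun setT f -> measurable [set w | f w < s].
Proof. exact: measurable_lt_level. Qed.

Lemma ratio_event_bounds (a b g e : R) : 0 < a -> 0 < b -> 0 < g -> 0 < e ->
  exists C r0 : R, forall r, r0 <= r ->
  al * be * N%:R * (g / a) ^+ N * expR (- e) * ln r - C <=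
  r ^+ N * fine (P [set w | (a * r) * (b * r) * Y w * X w ^+ 2 <
                     g * ((a * r) * Y w * X w + (b * r) * X w + 1)]) <=
  al * be * N%:R * (g / a) ^+ N * expR e * ln r + C.
Proof.
move=> a0 b0 g0 e0.
have N0' : (0 : R) < N%:R by rewrite ltr0n.
(* The upper bound loses [expR (N h)] twice, in the product tail and in [E ^+ N]; each loss is
   [expR (e / 2)]. *)
have [h hE] : exists h, h = e / 2 / N%:R by eexists.
have h0 : 0 < h by rewrite hE !divr_gt0.
have Nh : N%:R * h = e / 2 by rewrite hE mulrC divfK// gt_eqF.
have [C HC] := product_tail _ _ _ _ _ _ mX mY Y0 indXY _ _ _ _ _
  al0 be0 K10 K20 HF HG _ h0.
have [k kE] : exists k, k = g / a by eexists.
have k0 : 0 < k by rewrite kE divr_gt0.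
have [E EE] : exists E, E = expR h by eexists.
have E1 : 1 < E by rewrite EE -expR0 ltr_expR.
(* With [s = b r X] and [y = a r X Y] the event reads [y (s - g) < g (s + 1)]. The condition
   [s >= S] is exactly [s + 1 <= E (s - g)], whence [y < g E]. *)
have [S SE] : exists S, S = (1 + g * E) / (E - 1) by eexists.
have S0 : 0 < S by rewrite SE divr_gt0 ?subr_gt0// addr_gt0// mulr_gt0// (lt_trans _ E1).
have [c cE] : exists c, c = al * be * N%:R by eexists.
have c0 : 0 <= c by rewrite cE !mulr_ge0// ltW.
have kN0 : 0 <= k ^+ N by rewrite exprn_ge0// ltW.
have E0 : 0 < E by rewrite (lt_trans _ E1).
have EN : E ^+ N = expR (N%:R * h) by rewrite EE expRM_natl.
rewrite -kE -cE.
pose mev r := [set w | (a * r) * (b * r) * Y w * X w ^+ 2 <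
                     g * ((a * r) * Y w * X w + (b * r) * X w + 1)].
have mmev r : measurable (mev r).
  rewrite /mev; under eq_set do rewrite -subr_lt0.
  apply: mlt; apply: measurable_funB.
    by apply: measurable_funM; [apply: measurable_funM|exact: measurable_funX].
  apply: measurable_funM => //; apply: measurable_funD => //; apply: measurable_funD.
    by apply: measurable_funM => //; apply: measurable_funM.
  exact: measurable_funM.
have mXY : measurable_fun setT (fun w => X w * Y w) by exact: measurable_funM.
have p_le A B : measurable A -> measurable B -> A `<=` B -> fine (P A) <= fine (P B).
  by move=> mA mB AB; rewrite fine_le ?fin_num_measure//; apply: le_measure; rewrite ?inE.
have kE0 : 0 < k * E by exact: mulr_gt0.
have [Clo CloE] : exists Clo, Clo = k ^+ N * (c * `|ln k| + `|C|) by eexists.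
have [Chi ChiE] : exists Chi, Chi = (k * E) ^+ N *
  (c * expR (e / 2) * `|ln (k * E)| + `|C|) + al * (S / b) ^+ N by eexists.
have Clo0 : 0 <= Clo by rewrite CloE mulr_ge0// addr_ge0// mulr_ge0.
have Chi0 : 0 <= Chi.
  rewrite ChiE; apply: addr_ge0; last by rewrite mulr_ge0// exprn_ge0// divr_ge0// ltW.
  apply: mulr_ge0; first exact: exprn_ge0 (ltW kE0).
  apply: addr_ge0 => //; apply: mulr_ge0 => //; apply: mulr_ge0 => //; exact: expR_ge0.
(* Beyond this threshold [k / r] and [k E / r] are below 1, as the product tail requires. *)
exists (Clo + Chi), (k * E + 1) => r rr.
have kE1 : k < k * E by rewrite ltr_pMr.
have r1 : 1 <= r by apply: le_trans rr; rewrite lerDr ltW.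
have r0 : 0 < r by exact: lt_le_trans r1.
have l0 : 0 <= ln r by exact: ln_ge0.
have nC := ler_norm C; have nC' := ler_norm (- C); rewrite normrN in nC'.
have rN0 : 0 < r ^+ N by exact: exprn_gt0.
apply/andP; split.
  apply: (@le_trans _ _ (r ^+ N * fine (P [set w | X w * Y w < k / r]))); last first.
    rewrite ler_wpM2l ?(ltW rN0)//; apply: p_le; [exact: mlt|exact: mmev|].
    (* With [y] and [s] as above, [y < g] gives [y s <= g s < g (y + s + 1)]. *)
    move=> w /=; rewrite ltr_pdivlMr// kE ltr_pdivlMr// => XYg.
    have xb : 0 <= b * r * X w by rewrite !mulr_ge0// ltW.
    have ay : 0 <= a * r * Y w * X w by rewrite !mulr_ge0// ltW.
    have := ler_wpM2l xb (ltW XYg) => h1.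
    have := mulr_ge0 (ltW g0) ay => h2; nra.
  have kr : 0 < k / r < 1.
    by rewrite divr_gt0//= ltr_pdivrMr// mul1r (lt_le_trans kE1)//; lra.
  have /andP[lo _] := HC _ kr.
  apply: (@le_trans _ _ (r ^+ N * ((k / r) ^+ N * (c * expR (- (N%:R * h)) * - ln (k / r) - C)))); last first.
    by rewrite ler_wpM2l ?(ltW rN0)// cE.
  rewrite expr_div_n mulrA mulrCA mulfV ?gt_eqF// mulr1 ln_div ?posrE//.
  rewrite Nh; have e2 : expR (- e) <= expR (- (e / 2)) by rewrite ler_expR; lra.
  have e21 : expR (- (e / 2)) <= 1 by rewrite -[leRHS]expR0 ler_expR; lra.
  have e20 := expR_ge0 (- (e / 2)).
  move: (ln r) l0 => l l0; move: (expR (- e)) (expR (- (e / 2))) e2 e21 e20 => x1 x2 e2 e21 e20.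
  have p1 : k ^+ N * (c * (x1 * l)) <= k ^+ N * (c * (x2 * l)).
    by rewrite !ler_wpM2l// ler_wpM2r.
  have p2 : k ^+ N * (c * (x2 * ln k)) <= k ^+ N * (c * `|ln k|).
    rewrite !ler_wpM2l//; apply: (@le_trans _ _ (x2 * `|ln k|)).
      by rewrite ler_wpM2l// ler_norm.
    by rewrite ler_piMl.
  have p3 : k ^+ N * C <= k ^+ N * `|C| by rewrite ler_wpM2l.
  move: CloE p1 p2 p3.
  by move: (k ^+ N) (ln k) `|ln k| `|C| => kn lk nlk nc -> *; lra.
pose A1 := [set w | X w < S / (b * r)]; pose A2 := [set w | X w * Y w < k * E / r].
have mA1 : measurable A1 by exact: mlt.
have mA2 : measurable A2 by exact: mlt.
have brS w : S / (b * r) <= X w -> S <= b * r * X w.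
  by rewrite ler_pdivrMr ?mulr_gt0// mulrC.
have sub : mev r `<=` A1 `|` A2.
  move=> w; rewrite /mev /A1 /A2 /= => ev.
  have [|/brS] := ltP (X w) (S / (b * r)); first by left.
  rewrite SE ler_pdivrMr ?subr_gt0// => sE; right.
  rewrite ltr_pdivlMr// kE [g / a * E]mulrAC ltr_pdivlMr//.
  have [s sE'] : exists s, s = b * r * X w by eexists.
  have [y yE] : exists y, y = a * r * Y w * X w by eexists.
  have ev' : y * s < g * (y + s + 1).
    rewrite yE sE'; move: ev; congr (_ < _); ring.
  rewrite -sE' in sE.
  have sg : 0 < s - g.
    rewrite -(pmulr_rgt0 _ E0).
    have s0 : 0 <= s by rewrite sE' !mulr_ge0// ltW.
    by move: sE s0; lra.
  have -> : X w * Y w * r * a = y by rewrite yE; ring.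
  rewrite -(ltr_pM2r sg).
  have := ler_wpM2l (ltW g0) sE.
  by move: ev'; lra.
have pU : fine (P (A1 `|` A2)) <= fine (P A1) + fine (P A2).
  rewrite -fineD ?fin_num_measure// fine_le ?fin_numD ?fin_num_measure//.
    exact: measurableU.
  exact: measureU2.
apply: (@le_trans _ _ (r ^+ N * (fine (P A1) + fine (P A2)))).
  rewrite ler_wpM2l ?(ltW rN0)//; apply: le_trans pU.
  by apply: p_le; [exact: mmev|exact: measurableU|].
have kr : 0 < k * E / r < 1.
  by rewrite divr_gt0//= ltr_pdivrMr// mul1r; move: rr; lra.
have /andP[_ hi] := HC _ kr.
have /andP[_ hi1] := HF (S / (b * r)) (divr_gt0 S0 (mulr_gt0 b0 r0)).
apply: (@le_trans _ _ (r ^+ N * (al * (S / (b * r)) ^+ N + (k * E / r) ^+ N *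
    (c * expR (N%:R * h) * - ln (k * E / r) + C)))).
  by rewrite ler_wpM2l ?(ltW rN0)// cE; apply: lerD.
have -> : (S / (b * r)) ^+ N = (S / b) ^+ N / r ^+ N.
  by rewrite invfM mulrA -expr_div_n.
rewrite [(k * E / r) ^+ N]expr_div_n mulrDr.
have -> : r ^+ N * (al * ((S / b) ^+ N / r ^+ N)) = al * (S / b) ^+ N.
  by field; rewrite gt_eqF.
rewrite [r ^+ N * (_ * _)]mulrA mulrCA mulfV ?gt_eqF// mulr1 ln_div ?posrE//.
have x20 := expR_ge0 (e / 2).
have x2x : expR (e / 2) * expR (e / 2) = expR e by rewrite -expRD; congr expR; field.
have p2 : (k * E) ^+ N * (c * expR (e / 2) * - ln (k * E)) <=
    (k * E) ^+ N * (c * expR (e / 2) * `|ln (k * E)|).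
  apply: ler_wpM2l; first exact: exprn_ge0 (ltW kE0).
  apply: ler_wpM2l; first exact: mulr_ge0.
  by rewrite -normrN ler_norm.
have p3 : (k * E) ^+ N * C <= (k * E) ^+ N * `|C|.
  by apply: ler_wpM2l => //; exact: exprn_ge0 (ltW kE0).
have p1 : (k * E) ^+ N * (c * expR (e / 2) * ln r) = c * k ^+ N * expR e * ln r.
  by rewrite exprMn EN Nh -x2x; ring.
rewrite Nh -p1; move: ChiE p2 p3.
move: ((k * E) ^+ N) (ln (k * E)) `|ln (k * E)| `|C| (expR _) (ln r) (al * _)
  => x1 x2 x3 x4 x5 x6 x7 -> *; lra.
Qed.
End outage.

(** * Ratio of the outage probability to [A_asym] *)

Theorem theorem3 (R : realType) (d : measure_display) (T : measurableType d)
    (P : probability T R) (N : nat) (eta theta d1 d2 tau gth : R)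
    (Rr Rt Ur Ut : 'M[R[i]]_N) (lam sig : 'I_N -> R)
    (re1 im1 re2 im2 : 'I_N -> T -> R) :
  (1 <= N)%N ->
  0 < eta -> eta <= 1 -> 0 < theta -> theta < 1 ->
  0 < d1 -> 0 < d2 -> 0 < tau -> 0 < gth ->
  (forall k, 0 < lam k) -> (forall k, 0 < sig k) ->
  eigendecomp Rr Ur lam -> eigendecomp Rt Ut sig ->
  injective lam -> injective sig ->
  iid_CSCG_pair P re1 im1 re2 im2 ->
  (outage P (sqrtm_of Ur lam) (sqrtm_of Ut sig) re1 im1 re2 im2
       eta theta d1 d2 tau gth rho
     / A_asym lam sig eta theta d1 d2 tau gth rho)
    @[rho --> +oo] --> (1 : R).
Proof.
move=> N0 e0 _ t0 t1 d10 d20 _ g0 lam0 sig0 Rre Rte injl injs [mZ [indZ lawZ]].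
set Z := coords re1 im1 re2 im2 in mZ indZ lawZ.
pose iota1 (b : bool) (k : 'I_N) : bool * bool * 'I_N := (true, b, k).
pose iota2 (b : bool) (k : 'I_N) : bool * bool * 'I_N := (false, b, k).
have inj1 b k b' k' : iota1 b k = iota1 b' k' -> b = b' /\ k = k' by case.
have inj2 b k b' k' : iota2 b k = iota2 b' k' -> b = b' /\ k = k' by case.
pose X w := sqnorm (sqrtm_of Ur lam *m cvec_of re1 im1 w).
pose Y w := sqnorm (rvec_of re2 im2 w *m sqrtm_of Ut sig).
have XE w : X w = qf _ _ Rr (gvec _ _ _ _ Z N iota1 w).
  by rewrite /X (sqnorm_sqrtm_col _ _ _ _ _ lam0 Rre).
have YE w : Y w = qf _ _ Rt^T (gvec _ _ _ _ Z N iota2 w).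
  rewrite /Y (sqnorm_sqrtm_row _ _ _ _ _ sig0 Rte); congr qf.
  by apply/matrixP => i j; rewrite !mxE.
have Rrp := eigendecomp_posdefmx _ _ _ _ _ lam0 Rre.
have Rtp := eigendecomp_tr_posdefmx _ _ _ _ _ sig0 Rte.
have X0 w : 0 <= X w by rewrite XE qf_ge0.
have Y0 w : 0 <= Y w by rewrite YE qf_ge0.
(* The first boolean tells the two hops apart, so [X] and [Y] are functions of disjoint groups of
   coordinates. *)
pose J1 : {set bool * bool * 'I_N} := [set z | z.1.1]%SET.
pose J2 : {set bool * bool * 'I_N} := [set z | ~~ z.1.1]%SET.
have J12 z : z \in J1 -> z \notin J2 by rewrite !inE negbK.
have mX1 : measurable_fun (setT : set (g_sigma_algebraType (cylinders _ _ _ _ Z J1))) X.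
  rewrite (_ : X = (fun w => qf _ _ Rr (gvec _ _ _ _ Z N iota1 w))); last first.
    by apply/funext => w; rewrite XE.
  by apply: measurable_qf => k; apply: cmeasurable_gvec => b j; rewrite inE.
have mY2 : measurable_fun (setT : set (g_sigma_algebraType (cylinders _ _ _ _ Z J2))) Y.
  rewrite (_ : Y = (fun w => qf _ _ Rt^T (gvec _ _ _ _ Z N iota2 w))); last first.
    by apply/funext => w; rewrite YE.
  by apply: measurable_qf => k; apply: cmeasurable_gvec => b j; rewrite inE.
have mX : measurable_fun setT X.
  exact: (measurableT_comp mX1 (measurable_id_cylinders _ _ _ _ _ mZ J1)).
have mY : measurable_fun setT Y.
  exact: (measurableT_comp mY2 (measurable_id_cylinders _ _ _ _ _ mZ J2)).
have indXY (A B : set R) : measurable A -> measurable B ->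
    P (X @^-1` A `&` Y @^-1` B) = (P (X @^-1` A) * P (Y @^-1` B))%E.
  move=> mA mB; apply: (cylinders_independent _ _ _ _ _ _ mZ indZ _ _ J12).
    by have := mX1 measurableT A mA; rewrite setTI.
  by have := mY2 measurableT B mB; rewrite setTI.
pose Dl := \prod_k lam k; pose Ds := \prod_k sig k.
have Dl0 : 0 < Dl by exact: prodr_gt0.
have Ds0 : 0 < Ds by exact: prodr_gt0.
have detr : complex.Re (\det Rr) = Dl by rewrite (det_eigendecomp _ _ _ _ _ Rre).
have dett : complex.Re (\det Rt^T) = Ds by rewrite det_tr (det_eigendecomp _ _ _ _ _ Rte).
have NF0 : (0 : R) < N`!%:R by rewrite ltr0n fact_gt0.
pose al := (N`!%:R * Dl)^-1; pose be := (N`!%:R * Ds)^-1.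
have al0 : 0 < al by rewrite invr_gt0 mulr_gt0.
have be0 : 0 < be by rewrite invr_gt0 mulr_gt0.
have to_fine (V : T -> R) (a b x : R) : measurable_fun setT V ->
    (a%:E <= P [set w | (V w < x)%R] <= b%:E)%E ->
    a <= fine (P [set w | V w < x]) <= b.
  move=> mV; have fP : P [set w | V w < x] \is a fin_num.
    by rewrite fin_num_measure//; exact: measurable_lt_level.
  by rewrite -!lee_fin fineK.
have [K1 K10 HX] := small_ball _ _ _ _ _ _ mZ indZ lawZ _ _ iota1 Rrp inj1.
have [K2 K20 HY] := small_ball _ _ _ _ _ _ mZ indZ lawZ _ _ iota2 Rtp inj2.
have HF x : 0 < x ->
    al * expR (- (K1 * x)) * x ^+ N <= fine (P [set w | X w < x]) <= al * x ^+ N.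
  move=> x0; apply: to_fine => //; under eq_set do rewrite XE.
  by have := HX x x0; rewrite detr.
have HG x : 0 < x ->
    be * expR (- (K2 * x)) * x ^+ N <= fine (P [set w | Y w < x]) <= be * x ^+ N.
  move=> x0; apply: to_fine => //; under eq_set do rewrite YE.
  by have := HY x x0; rewrite dett.
have D10 : 0 < d1 `^ tau by exact: powR_gt0.
have D20 : 0 < d2 `^ tau by exact: powR_gt0.
pose a := eta * theta / (d1 `^ tau * d2 `^ tau).
pose b := (1 - theta) / d1 `^ tau.
have a0 : 0 < a by rewrite divr_gt0 ?mulr_gt0.
have b0 : 0 < b by rewrite divr_gt0 ?subr_gt0.
have [C0 AE] := A_asymE _ _ lam sig eta theta d1 d2 tau gth N0 t1 d10 g0 lam0 sig0 injl injs.
pose c := leading_coef _ N lam sig eta theta d1 d2 tau gth.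
(* The factor [N] of the product tail turns one of the two [N!] into [(N-1)!], as in
   [leading_coef]. *)
have cE : c = al * be * N%:R * (gth / a) ^+ N.
  rewrite /c /leading_coef.
  have -> : gth * d1 `^ tau * (d2 `^ tau / (eta * theta)) = gth / a.
    by rewrite /a invf_div; ring.
  rewrite mulrC; congr (_ * _); rewrite /al /be -/Dl -/Ds.
  have NE : (N`!%:R : R) = N%:R * N.-1`!%:R by rewrite -natrM -{1 2}(prednK N0) factS prednK.
  have F0 : (0 : R) < N.-1`!%:R by rewrite ltr0n fact_gt0.
  have n0 : (0 : R) < N%:R by rewrite ltr0n.
  rewrite NE; move: (N.-1`!%:R : R) (N%:R : R) F0 n0 => F n F0 n0.
  by field; rewrite !gt_eqF.
have c0 : 0 < c.
  rewrite cE; apply: mulr_gt0; last exact: exprn_gt0 (divr_gt0 g0 a0).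
  by apply: mulr_gt0; [exact: mulr_gt0|rewrite ltr0n].
pose f r := r ^+ N * outage P (sqrtm_of Ur lam) (sqrtm_of Ut sig) re1 im1 re2 im2
       eta theta d1 d2 tau gth r.
have fcvg : f r / (c * ln r + C0) @[r --> +oo] --> (1 : R).
  apply: log_ratio_limit => // e ee0.
  have [C [r0 HC]] := ratio_event_bounds _ _ _ _ _ _ mX mY X0 Y0 indXY _ _ _ _ _ N0 (ltW al0) (ltW be0)
    K10 K20 HF HG _ _ _ _ a0 b0 g0 ee0.
  exists C, (Num.max r0 1) => r; rewrite ge_max => /andP[rr0 r1].
  have rpos : 0 < r by exact: lt_le_trans r1.
  rewrite cE /f /outage.
  rewrite (_ : [set w | _] = [set w | a * r * (b * r) * Y w * X w ^+ 2 <
      gth * (a * r * Y w * X w + b * r * X w + 1)]); first exact: HC.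
  apply/funext => w; congr is_true.
  by rewrite gammaI_ltE//; [exact: X0|exact: Y0].
(* For [r > 0] the power [r ^+ N] can be moved from denominator to numerator, so the two ratios
   coincide eventually. *)
apply: cvg_trans fcvg; apply: near_eq_cvg; near=> r.
have r0 : 0 < r by near: r; apply: nbhs_pinfty_gt; exact: num_real.
rewrite AE// -/c /f invf_div mulrA; congr (_ / _).
by rewrite mulrC.
Unshelve. all: by end_near.
Qed.
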